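(* Let $0<\aleph_1\le1\le\aleph_2<\infty$ be absolute constants, and consider a DSBM with $n$ nodes, $L$ time instants, in which at most $n_0$ nodes switch memberships between consecutive time instants and which is balanced: with $m$ classes, $\aleph_1 n/m\le n_k^{(l)}\le\aleph_2 n/m$ for all $k=1,\dots,m$, $l=1,\dots,L$, where $n_k^{(l)}$ is the number of nodes in class $k$ at time $l$. Let $\Lambda^*$ be the true tensor of connection probabilities, $m^*$ the true number of classes, $M^*=m^*(m^*+1)/2$, $Q^*\in\mathbb R^{M^*\times L}$ the true matrix of connection probabilities for pairs of classes, and $D^*=Q^*H^T$, where $H\in\mathbb R^{L\times L}$ is orthogonal. Suppose $n\ge\sqrt{e\,n_0^3}$ and let $\hat\Lambda$ be the penalized least squares estimator described in the context with penalty $$\mathrm{Pen}(|J|,m)=11\left[n\log m+n_0(L-1)\log\Big(\frac{mne}{n_0}\Big)+\frac{|J|}{2}\log\Big(\frac{25\,m^2L}{|J|}\Big)\right],\qquad J=\bigcup_{k=1}^MJ_k,$$ where $J_k$ is the part of the index set $J$ lying in row $k$ of the coefficient matrix. Then for any $t>0$, with probability at least $1-9e^{-t}$, $$\frac{\|\hat\Lambda-\Lambda^*\|^2}{n^2L}\le\min_J\left\{\frac{6\aleph_2^2}{(m^* )^2L}\sum_{k=1}^{M^*}\sum_{l\notin J_k}(D^*_{k,l})^2+\frac{4\,\mathrm{Pen}(|J|,m^* )}{n^2L}\right\}+\frac{38\,t}{n^2L},$$ and similarly for the expectation, $$\mathbb E\left(\frac{\|\hat\Lambda-\Lambda^*\|^2}{n^2L}\right)\le\min_J\left\{\frac{6\aleph_2^2}{(m^*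 )^2L}\sum_{k=1}^{M^*}\sum_{l\notin J_k}(D^*_{k,l})^2+\frac{4\,\mathrm{Pen}(|J|,m^* )}{n^2L}\right\}+\frac{342}{n^2L}.$$ The minima are over families $(J_k)_{k=1}^{M^*}$ of subsets of $\{1,\dots,L\}$, not all empty, with $|J|=\sum_k|J_k|$.
   Context: Observations: $B_{i,j,l}\in\{0,1\}$ for $1\le i,j\le n$, $1\le l\le L$, with $B_{i,j,l}=B_{j,i,l}$, $B_{i,i,l}=0$, and $\{B_{i,j,l}: i<j,\ 1\le l\le L\}$ independent Bernoulli variables with $\mathbb P(B_{i,j,l}=1)=\Lambda^*_{i,j,l}$; $\Lambda^*_{i,i,l}=0$, $\Lambda^*_{i,j,l}=\Lambda^*_{j,i,l}$. Clustering matrices: $\mathcal M(m,n)$ is the set of $Z\in\{0,1\}^{n\times m}$ with exactly one 1 in each row; $Z_{ik}=1$ iff node $i$ belongs to class $\Omega_k$. $\mathcal Z_{\rm bal}(m,n,n_0,L,\aleph_1,\aleph_2)$ is the set of sequences $(Z^{(1)},\dots,Z^{(L)})\in\prod_{l=1}^L\mathcal M(m,n)$ such that at most $n_0$ nodes change class between consecutive times and every class $k$ at every time $l$ has size $n_k^{(l)}\in[\aleph_1n/m,\aleph_2n/m]$. DSBM with $m$ classes: at each time $l$ nodes are grouped by $Z^{(l)}\in\mathcal M(m,n)$, and $\Lambda_{i,j,l}=G_{k,k',l}$ ($i\ne j$) if $i\in\Omega_k$, $j\in\Omega_{k'}$ at time $l$, where $G\in[0,1]^{m\times m\times L}$, $G_{k,k',l}=G_{k',k,l}$.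 The true sequence of clustering matrices belongs to $\mathcal Z_{\rm bal}(m^*,n,n_0,L,\aleph_1,\aleph_2)$. Vectorization: $N=n(n-1)/2$, $M=m(m+1)/2$. $a^{(l)},\theta^{(l)}\in\mathbb R^N$ are the vectors of entries $B_{i_1,i_2,l}$, $\Lambda_{i_1,i_2,l}$ with $i_1<i_2$; $q^{(l)}\in\mathbb R^M$ is the vector of $G_{k_1,k_2,l}$ with $k_1\le k_2$; $Q\in\mathbb R^{M\times L}$ has columns $q^{(l)}$. $C^{(l)}\in\{0,1\}^{N\times M}$ has entry 1 in row $(i_1,i_2)$ and column $(k_1,k_2)$ iff under $Z^{(l)}$ one of $i_1,i_2$ is in $\Omega_{k_1}$ and the other is in $\Omega_{k_2}$. $a,\theta\in\mathbb R^{NL}$, $q=\mathrm{vec}(Q)\in\mathbb R^{ML}$ are obtained by stacking over $l$, and $C$ is block diagonal with blocks $C^{(1)},\dots,C^{(L)}$, so $\theta=Cq$. Sequences of clustering matrices are identified with their matrices $C$. Transform: $D=QH^T\in\mathbb R^{M\times L}$, $d=\mathrm{vec}(D)=Wq$, $W=H\otimes I_M$. A set $J$ of indices of $d$ is identified with a set of positions $(k,l)$ in $D$, and $J_k=\{l:(k,l)\in J\}$. Estimator: $(\hat m,\hat J,\hat d,\hat C)$ is any minimizer of $\|a-CW^Td\|^2+\mathrm{Pen}(|J|,m)$ over $m\in\{1,\dots,n\}$, nonempty $J\subseteq\{1,\dots,ML\}$, $d\in\mathbb R^{ML}$ with $d_j=0$ for $j\notin J$, and $C\in\mathcal Z_{\rm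 bal}(m,n,n_0,L,\aleph_1,\aleph_2)$. With $\hat W=H\otimes I_{\hat m(\hat m+1)/2}$ put $\hat\theta=\hat C\hat W^T\hat d$; $\hat\Lambda$ is the tensor, symmetric in its first two indices with zero diagonals, whose vectorized version is $\hat\theta$. Convention: the term $n_0\log(mne/n_0)$ is $0$ if $n_0=0$. $\|\cdot\|$ is the Euclidean norm for vectors and the square root of the sum of squared entries for tensors. *)

(* Defs.v *)
From HB Require Import structures.
From mathcomp Require Import all_boot all_order all_algebra.
From mathcomp Require Import mxtens.
From mathcomp Require Import all_classical all_reals all_analysis.

Set Implicit Arguments.
Unset Strict Implicit.
Unset Printing Implicit Defensive.

Import Order.TTheory GRing.Theory Num.Theory.
Import numFieldNormedType.Exports.

Local Open Scope ring_scope.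

(* Unordered pairs of distinct nodes and unordered pairs of classes; vectors
   and matrices with rows indexed by them use the positions in [enum]. *)
Notation node_pair n := {p : 'I_n * 'I_n | (p.1 < p.2)%N}.
Notation class_pair m := {p : 'I_m * 'I_m | (p.1 <= p.2)%N}.

Definition Ndim (n : nat) : nat := #|{: node_pair n}|.
Definition Mdim (m : nat) : nat := #|{: class_pair m}|.

Lemma NdimE (n : nat) : Ndim n = (n * n.-1)./2.
Proof.
rewrite /Ndim card_sig -sum1_card.
rewrite -(pair_big_dep predT (fun i j : 'I_n => (i < j)%N) (fun _ _ => 1%N)) /=.
rewrite (exchange_big_dep predT) //= -bin2 -bin2_sum big_mkord.
apply: eq_bigr => j _; rewrite (big_ord_narrow (ltnW (ltn_ord j))) /=.
by rewrite sum1_card card_ord.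
Qed.

Lemma MdimE (m : nat) : Mdim m = (m * m.+1)./2.
Proof.
rewrite /Mdim card_sig -sum1_card.
rewrite -(pair_big_dep predT (fun i j : 'I_m => (i <= j)%N) (fun _ _ => 1%N)) /=.
rewrite (exchange_big_dep predT) //= mulnC -(bin2 m.+1) -bin2_sum big_mkord.
rewrite big_ord_recl add0n; apply: eq_bigr => j _.
rewrite (eq_bigl (fun i : 'I_m => (i < j.+1)%N)) //.
by rewrite (big_ord_narrow (ltn_ord j)) sum1_card card_ord.
Qed.

Definition node1 n (r : 'I_(Ndim n)) : 'I_n := (val (enum_val r)).1.
Definition node2 n (r : 'I_(Ndim n)) : 'I_n := (val (enum_val r)).2.
Definition class1 m (c : 'I_(Mdim m)) : 'I_m := (val (enum_val c)).1.
Definition class2 m (c : 'I_(Mdim m)) : 'I_m := (val (enum_val c)).2.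

Definition tensor (R : Type) (n m L : nat) := 'I_n -> 'I_m -> 'I_L -> R.

Definition symmetric_slices R n L (X : tensor R n n L) : Prop :=
  forall i j l, X i j l = X j i l.

Definition zero_diagonals (R : pzRingType) n L (X : tensor R n n L) : Prop :=
  forall i l, X i i l = 0.

Definition tensor_sqnorm (R : pzRingType) n m L (X : tensor R n m L) : R :=
  \sum_i \sum_j \sum_l X i j l ^+ 2.

Definition sqnorm (R : pzRingType) n (v : 'cV[R]_n) : R :=
  \sum_i v i 0 ^+ 2.

(* In dimension L * K, the index [mxtens_index (l, k)] is l * K + k: entry k of
   block l. This is the ordering used by the Kronecker product [*t]. *)
Definition stack (R : Type) L K (v : 'I_L -> 'cV[R]_K) : 'cV[R]_(L * K) :=
  \col_r v (mxtens_unindex r).1 (mxtens_unindex r).2 ord0.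

Definition block_diagonal (R : pzRingType) L N M (A : 'I_L -> 'M[R]_(N, M)) :
  'M[R]_(L * N, L * M) := \sum_l delta_mx l l *t A l.

Definition vectorize (R : Type) n L (X : tensor R n n L) :
    'cV[R]_(L * Ndim n) :=
  stack (fun l => \col_r X (node1 r) (node2 r) l).

Definition is_clustering n m (Z : 'M[bool]_(n, m)) : Prop :=
  forall i, #|[pred k | Z i k]| = 1%N.

Definition class_size n m (Z : 'M[bool]_(n, m)) (k : 'I_m) : nat :=
  #|[pred i | Z i k]|.

Definition n_switches n m (Z Z' : 'M[bool]_(n, m)) : nat :=
  #|[pred i | row i Z != row i Z']|.

Definition Zbal (R : realType) (m n n0 L : nat) (aleph1 aleph2 : R)
    (Z : 'I_L -> 'M[bool]_(n, m)) : Prop :=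
  [/\ forall l, is_clustering (Z l),
      forall l l' : 'I_L, l' = l.+1 :> nat -> (n_switches (Z l) (Z l') <= n0)%N
    & forall l k, aleph1 * n%:R / m%:R <= (class_size (Z l) k)%:R
                                       <= aleph2 * n%:R / m%:R].

Definition clustering_mx (R : pzRingType) n m (Z : 'M[bool]_(n, m)) :
    'M[R]_(Ndim n, Mdim m) :=
  \matrix_(r, c) (Z (node1 r) (class1 c) && Z (node2 r) (class2 c)
               || Z (node1 r) (class2 c) && Z (node2 r) (class1 c))%:R.

Definition is_DSBM (R : realType) n m L (Z : 'I_L -> 'M[bool]_(n, m))
    (G : tensor R m m L) (Lam : tensor R n n L) : Prop :=
  [/\ forall k k' l, 0 <= G k k' l <= 1,
      symmetric_slices G,
      zero_diagonals Lam
    & forall i j l k k', i != j -> Z l i k -> Z l j k' ->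
        Lam i j l = G k k' l].

Definition class_prob_mx (R : Type) m L (G : tensor R m m L) :
    'M[R]_(Mdim m, L) :=
  \matrix_(k, l) G (class1 k) (class2 k) l.

Definition transform_mx (R : pzRingType) L (H : 'M[R]_L) M : 'M[R]_(L * M) :=
  H *t (1%:M : 'M[R]_M).

(* At n0 = 0 the switching term is 0, since ln (_ / 0) is multiplied by 0. *)
Definition Pen (R : realType) (n n0 L s m : nat) : R :=
  11 * (n%:R * ln m%:R
        + n0%:R * (L%:R - 1) * ln (m%:R * n%:R * expR 1 / n0%:R)
        + s%:R / 2 * ln (25 * m%:R ^+ 2 * L%:R / s%:R)).

Record candidate (R : Type) (n L : nat) := Candidate {
  cand_m : nat;
  cand_J : {set 'I_(L * Mdim cand_m)};
  cand_d : 'cV[R]_(L * Mdim cand_m);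
  cand_Z : 'I_L -> 'M[bool]_(n, cand_m) }.

Definition feasible (R : realType) n n0 L (aleph1 aleph2 : R)
    (c : candidate R n L) : Prop :=
  [/\ (1 <= cand_m c <= n)%N,
      cand_J c != finset.set0,
      forall j, j \notin cand_J c -> cand_d c j 0 = 0
    & Zbal n0 aleph1 aleph2 (cand_Z c)].

Definition fitted (R : realType) n L (H : 'M[R]_L) (c : candidate R n L) :
    'cV[R]_(L * Ndim n) :=
  block_diagonal (fun l => clustering_mx R (cand_Z c l))
    *m (transform_mx H (Mdim (cand_m c)))^T *m cand_d c.

Definition objective (R : realType) n n0 L (H : 'M[R]_L)
    (a : 'cV[R]_(L * Ndim n)) (c : candidate R n L) : R :=
  sqnorm (a - fitted H c) + Pen R n n0 L #|cand_J c| (cand_m c).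

Definition is_PLS_estimator (R : realType) n n0 L (aleph1 aleph2 : R)
    (H : 'M[R]_L) (a : 'cV[R]_(L * Ndim n)) (c : candidate R n L) : Prop :=
  feasible n0 aleph1 aleph2 c /\
  forall c', feasible n0 aleph1 aleph2 c' ->
    objective n0 H a c <= objective n0 H a c'.

Definition oracle_term (R : realType) (n n0 m L : nat) (aleph2 : R)
    (D : 'M[R]_(Mdim m, L)) (J : {ffun 'I_(Mdim m) -> {set 'I_L}}) : R :=
  6 * aleph2 ^+ 2 / (m%:R ^+ 2 * L%:R)
    * (\sum_(k < Mdim m) \sum_(l < L | l \notin J k) D k l ^+ 2)
  + 4 * Pen R n n0 L (\sum_k #|J k|)%N m / (n%:R ^+ 2 * L%:R).

(* The default argument of [arg min] is itself admissible as soon as m and L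
   are positive. *)
Definition oracle_bound (R : realType) (n n0 m L : nat) (aleph2 : R)
    (D : 'M[R]_(Mdim m, L)) : R :=
  let F := oracle_term n n0 aleph2 D in
  F [arg min_(J < [ffun=> [set: 'I_L]%SET] |
       [exists k, J k != finset.set0]) F J]%O.

Local Open Scope classical_set_scope.
Local Open Scope ereal_scope.

Definition mutually_independent d d' (T : measurableType d)
    (U : measurableType d') (R : realType) (P : probability T R)
    (I : finType) (X : I -> {RV P >-> U}) : Prop :=
  forall (S : {set I}) (A : I -> set U), (forall i, measurable (A i)) ->
    P [set w | forall i, i \in S -> A i (X i w)] =
    \prod_(i in S) P (X i @^-1` A i).

(* Main.v *)
(* Write a = theta* + xi for the vectorized data, x = hat theta - theta* and
   v = theta_J - theta*, where theta_J keeps the true coefficients in the oracle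
   set J. Comparing the values of the criterion at the estimator and at the
   oracle gives
     |x|^2 <= 3 |v|^2 + 2 Pen_J + (-4 xi.v - |v|^2) + 4 (|Pi xi|^2 - hat Pen / 2),
   where Pi projects onto the span of theta* and of the fits of the selected
   model. Both brackets are at most a multiple of ln Psi, where Psi is
     1 + exp (-2 xi.v - |v|^2 / 2) + sum over models of exp (|Pi xi|^2 - Pen / 2).
   Hoeffding's lemma and a linearization of |Pi xi|^2 bound E exp (|Pi xi|^2) by
   7 ^ (|J| + 1), and counting the models then gives E Psi <= 9. The deviation
   bound is Markov's inequality for Psi, and the bound in expectation follows
   from ln Psi <= Psi. Finally |v|^2 is at most (aleph2 n / m)^2 times the energy
   of D* outside J, because a pair of classes contains at most that many pairs
   of nodes. *)

Require Import Defs.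
From mathcomp Require Import all_boot all_order all_algebra.
From mathcomp Require Import mxtens zify ring lra.
From mathcomp Require Import all_classical all_reals all_analysis.
From mathcomp Require Import measurable_realfun.

Import Order.TTheory GRing.Theory Num.Theory.
Import numFieldNormedType.Exports.
Local Open Scope classical_set_scope.
Local Open Scope ring_scope.

Set Implicit Arguments.
Unset Strict Implicit.
Unset Printing Implicit Defensive.

(** * Hoeffding's lemma for centered Bernoulli variables *)

Lemma is_derive_le_at0 (R : realType) (f df : R -> R) :
  (forall x : R, is_derive x (1 : R) f (df x)) ->
  (forall x, 0 < x -> 0 <= df x) ->
  forall x, 0 <= x -> f 0 <= f x.
Proof.
move=> Df df0 x x0; apply: (@ger0_derive1_ndecry _ f 0) => //.
- move=> y; rewrite in_itv /= andbT => y0.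
  by rewrite derive1E; have [_ ->] := Df y; exact: df0.
- apply: continuous_subspaceT => y; apply: differentiable_continuous.
  by apply/derivable1_diffP; have [] := Df y.
Qed.

(* With [u = 1 - p + p e^c], the logarithm of the quotient of the two sides
   vanishes to first order at 0 and has second derivative
   [1/4 - (1 - p) p e^c / u^2 >= 0]. *)
Lemma hoeffding_bernoulli_ge0 (R : realType) (p c : R) :
  0 <= p <= 1 -> 0 <= c ->
  p * expR (c * (1 - p)) + (1 - p) * expR (- (c * p)) <= expR (c ^+ 2 / 8).
Proof.
move=> /andP[p0 p1] c0.
pose u (x : R) := 1 - p + p * expR x.
have u_gt0 x : 0 < u x.
  rewrite /u; have := expR_gt0 x; case: (ltP p 1) => [p1'|p1'] e0.
    by have := mulr_ge0 p0 (ltW e0); lra.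
  have -> : p = 1 by apply/eqP; rewrite eq_le p1.
  by rewrite mul1r subrr add0r.
pose g1 (x : R) := x / 4 + p - 1 + (1 - p) * (u x)^-1.
pose g (x : R) := x ^+ 2 / 8 + x * p - ln (u x).
have Du x : is_derive x (1 : R) u (p * expR x).
  have -> : u = cst (1 - p) + p *: expR by apply/funext.
  apply: (is_derive_eq (is_deriveD (is_derive_cst _ _ _)
    (is_deriveZ _ (is_derive_expR x)))).
  by rewrite add0r.
have Dg1 x : is_derive x (1 : R) g1
    (1 / 4 - (1 - p) * (u x ^- 2 * (p * expR x))).
  have -> : g1 = (4^-1 *: id + cst (p - 1)) + (1 - p) *: (fun y => (u y)^-1).
    by apply/funext => y; rewrite /g1 /= !fctE /= /GRing.scale /=; ring.
  have uV : is_derive x (1 : R) (fun y => (u y)^-1)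
      (- (u x) ^- 2 *: (p * expR x)).
    by apply: is_deriveV (Du x); rewrite gt_eqF.
  apply: (is_derive_eq (is_deriveD (is_deriveD
    (is_deriveZ _ (is_derive_id _ _)) (is_derive_cst _ _ _))
    (is_deriveZ _ uV))).
  by rewrite /GRing.scale /=; field; rewrite gt_eqF.
have Dg x : is_derive x (1 : R) g (g1 x).
  have -> : g = (8^-1 *: (id ^+ 2) + p *: id) - (@ln R \o u).
    by apply/funext => y; rewrite /g /= !fctE /= /GRing.scale /=; ring.
  have Dl : is_derive x (1 : R) (@ln R \o u) ((u x)^-1 * (p * expR x)).
    by apply: (is_derive1_comp (is_derive1_ln (u_gt0 x)) (Du x)).
  apply: (is_derive_eq (is_deriveB (is_deriveD
    (is_deriveZ _ (is_deriveX _ (is_derive_id _ _)))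
    (is_deriveZ _ (is_derive_id _ _))) Dl)).
  rewrite /g1 /GRing.scale /= /u; field.
  by have := u_gt0 x; rewrite /u => h; rewrite gt_eqF.
have g1_ge0 x : 0 <= x -> 0 <= g1 x.
  move=> x0; have <- : g1 0 = 0.
    by rewrite /g1 /u expR0 mulr1 subrK invr1; ring.
  apply: (is_derive_le_at0 Dg1) => // {x0}x _.
  suff : (1 - p) * (u x ^- 2 * (p * expR x)) <= 1 / 4 by lra.
  rewrite mulrCA mulrC -ler_pdivlMr ?invr_gt0 ?exprn_gt0// invrK.
  (* Arithmetic-geometric mean: four times the product of [1 - p] and [p * expR x] is at most the
     square of their sum [u x]. *)
  by have := sqr_ge0 (1 - p - p * expR x); rewrite /u; nra.
have : 0 <= g c.
  have <- : g 0 = 0.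
    by rewrite /g /u expR0 mulr1 subrK ln1; ring.
  by apply: (is_derive_le_at0 Dg) => // x /ltW; exact: g1_ge0.
rewrite /g subr_ge0 => h.
have -> : p * expR (c * (1 - p)) + (1 - p) * expR (- (c * p)) =
          expR (ln (u c) - c * p).
  rewrite expRD lnK ?posrE// /u (_ : c * (1 - p) = c - c * p); last by ring.
  by rewrite !expRD; ring.
by rewrite ler_expR; lra.
Qed.

(** For negative [c] the two outcomes are exchanged: replacing [(p, c)] by [(1 - p, - c)] swaps the
    two summands. *)
Lemma hoeffding_bernoulli (R : realType) (p c : R) : 0 <= p <= 1 ->
  p * expR (c * (1 - p)) + (1 - p) * expR (- (c * p)) <= expR (c ^+ 2 / 8).
Proof.
move=> p01; have [c0|/ltW c0] := leP 0 c; first exact: hoeffding_bernoulli_ge0.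
have p01' : 0 <= 1 - p <= 1 by apply/andP; split; lra.
have := hoeffding_bernoulli_ge0 p01' (c := - c).
rewrite sqrrN oppr_ge0 (_ : 1 - (1 - p) = p); last by ring.
rewrite mulNr (_ : - (- c * (1 - p)) = c * (1 - p)); last by ring.
by rewrite [leLHS in _ -> leLHS <= _]addrC; apply.
Qed.

(** * Numerical bounds on the exponential *)

Lemma expR_quarter_le (R : realType) : expR (1 / 4 : R) <= 4 / 3.
Proof.
have h := expR_ge1Dx (- (1 / 4) : R).
rewrite -[X in _ <= X]invrK invf_div -[X in X <= _]invrK -expRN.
by rewrite lef_pV2 ?posrE ?expR_gt0//; lra.
Qed.

Lemma expRN_half_le (R : realType) : expR (- (1 / 2) : R) <= 2 / 3.
Proof.
have h := expR_ge1Dx (1 / 2 : R).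
by rewrite expRN -[X in _ <= X]invrK invf_div lef_pV2 ?posrE ?expR_gt0//; lra.
Qed.

(** The inequality [1 + x <= expR x] at [x = - 1/8] gives [expR (1/8) <= 8/7], and [(8/7)^8] is
    about 2.91. *)
Lemma expR1_le3 (R : realType) : expR 1 <= 3 :> R.
Proof.
have h := expR_ge1Dx (- (1 / 8) : R).
have h2 : expR (1 / 8) <= 8 / 7 :> R.
  rewrite -[X in _ <= X]invrK invf_div -[X in X <= _]invrK -expRN.
  by rewrite lef_pV2 ?posrE ?expR_gt0//; lra.
have -> : 1 = 8%:R * (1 / 8) :> R by field.
rewrite expRM_natl; apply: le_trans (_ : (8 / 7) ^+ 8 <= _).
  by rewrite lerXn2r ?nnegrE ?expR_ge0//; lra.
by rewrite -subr_ge0; lra.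
Qed.

(** * Projections and Bernoulli noise *)

Definition dotp (R : pzRingType) n (u v : 'cV[R]_n) : R := (u^T *m v) 0 0.

Section Dotp.
Variables (R : comPzRingType) (n : nat).
Implicit Types u v w : 'cV[R]_n.

Lemma dotpE u v : dotp u v = \sum_i u i 0 * v i 0.
Proof. by rewrite /dotp mxE; apply: eq_bigr => i _; rewrite mxE. Qed.

Lemma sqnormE u : sqnorm u = dotp u u.
Proof. by rewrite dotpE; apply: eq_bigr => i _; rewrite expr2. Qed.

Lemma dotpC u v : dotp u v = dotp v u.
Proof. by rewrite !dotpE; apply: eq_bigr => i _; rewrite mulrC. Qed.

Lemma dotpDl u v w : dotp (u + v) w = dotp u w + dotp v w.
Proof. by rewrite /dotp linearD /= mulmxDl mxE. Qed.

Lemma dotpNl u v : dotp (- u) v = - dotp u v.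
Proof. by rewrite /dotp linearN /= mulNmx mxE. Qed.

Lemma dotpZl a u v : dotp (a *: u) v = a * dotp u v.
Proof. by rewrite /dotp linearZ /= -scalemxAl mxE. Qed.

Lemma dotp_mulmxl m (A : 'M[R]_(n, m)) (u : 'cV[R]_m) v :
  dotp (A *m u) v = dotp u (A^T *m v).
Proof. by rewrite /dotp trmx_mul mulmxA. Qed.

Lemma sqnormB u v : sqnorm (u - v) = sqnorm u - 2 * dotp u v + sqnorm v.
Proof.
rewrite !sqnormE !(dotpDl, dotpNl) ![dotp _ (u - v)]dotpC.
by rewrite !(dotpDl, dotpNl) (dotpC v u); ring.
Qed.

Lemma sqnormZ a u : sqnorm (a *: u) = a ^+ 2 * sqnorm u.
Proof. by rewrite !sqnormE dotpZl dotpC dotpZl; ring. Qed.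

End Dotp.

Lemma sqnorm_ge0 (R : realDomainType) n (u : 'cV[R]_n) : 0 <= sqnorm u.
Proof. by apply: sumr_ge0 => i _; exact: sqr_ge0. Qed.

(* Gram-Schmidt; a vector depending on the previous ones contributes a zero
   column to [E]. *)
Lemma gram_schmidt (R : rcfType) N r (A : 'M[R]_(N, r)) :
  exists E : 'M[R]_(N, r), E *m E^T *m A = A /\ E *m E^T *m E = E.
Proof.
elim: r A => [|r IH] A; first by exists A; split; apply/matrixP => i [].
rewrite -[A](@hsubmxK _ N 1 r); move: (lsubmx _) (rsubmx _) => u B.
have [F [FB FF]] := IH B.
pose w := u - F *m F^T *m u.
have FTw : F^T *m w = 0.
  have : F^T *m F *m F^T = F^T.
    by have := congr1 trmx FF; rewrite !trmx_mul trmxK mulmxA.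
  by move=> h; rewrite /w mulmxBr !mulmxA h subrr.
have wTF : w^T *m F = 0.
  by have := congr1 trmx FTw; rewrite trmx_mul trmxK trmx0.
have wTw : w^T *m w = (sqnorm w)%:M.
  by rewrite [LHS]mx11_scalar sqnormE.
(* When [w = 0], also [c = 0], because the inverse of 0 is 0. So [cw] holds in both cases and no
   case split is needed afterwards. *)
pose c := (Num.sqrt (sqnorm w))^-1.
have cw : (c ^+ 2 * sqnorm w) *: w = w.
  rewrite /c exprVn sqr_sqrtr ?sqnorm_ge0//.
  have [w0|w0] := eqVneq (sqnorm w) 0; last by rewrite mulVf// scale1r.
  suff -> : w = 0 by rewrite scaler0.
  move/eqP: w0; rewrite psumr_eq0 => [/allP w0|i _]; last exact: sqr_ge0.
  apply/colP => i; rewrite [RHS]mxE; apply/eqP.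
  by have := w0 i; rewrite mem_index_enum sqrf_eq0; apply.
have wTu : w^T *m u = (sqnorm w)%:M.
  rewrite -wTw [in RHS]/w mulmxBr [in RHS]mulmxA [in RHS]mulmxA wTF.
  by rewrite !mul0mx subr0.
pose e := c *: w.
have eE : e *m e^T = c ^+ 2 *: (w *m w^T).
  by rewrite /e linearZ /= -scalemxAl -scalemxAr scalerA expr2.
have ewE X (a : R) : w^T *m X = a%:M -> e *m e^T *m X = (c ^+ 2 * a) *: w.
  by move=> h; rewrite eE -scalemxAl -mulmxA h mul_mx_scalar scalerA.
have e0E s (X : 'M[R]_(N, s)) : w^T *m X = 0 -> e *m e^T *m X = 0.
  by move=> h; rewrite eE -scalemxAl -mulmxA h mulmx0 scaler0.
exists (row_mx e F : 'M[R]_(N, 1 + r)).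
rewrite (@tr_row_mx _ N 1 r) (@mul_row_col _ N 1 r).
rewrite !(@mul_mx_row _ _ _ 1 r) !mulmxDl.
have wTB : w^T *m B = 0 by rewrite -FB !mulmxA wTF !mul0mx.
split; apply: (congr2 (@row_mx _ N 1 r)).
- by rewrite (ewE _ _ wTu) cw /w subrK.
- by rewrite FB e0E// add0r.
- have wTe : w^T *m e = (c * sqnorm w)%:M.
    by rewrite /e -scalemxAr wTw scale_scalar_mx.
  rewrite (ewE _ _ wTe) /e -scalemxAr -mulmxA FTw mulmx0 scaler0 addr0.
  by rewrite mulrCA -scalerA cw.
- by rewrite FF e0E// add0r.
Qed.

(** [E^T E] is an orthogonal projection, so the difference of the two sides is the squared norm of
    the residual [g - E^T E g]. *)
Lemma sqnorm_partial_isometry (R : realDomainType) N r (E : 'M[R]_(N, r)) g :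
  E *m E^T *m E = E -> sqnorm (E *m g) <= sqnorm g.
Proof.
move=> EE; rewrite -subr_ge0.
suff -> : sqnorm g - sqnorm (E *m g) = sqnorm (g - E^T *m (E *m g)).
  exact: sqnorm_ge0.
have EEh : E *m (E^T *m (E *m g)) = E *m g by rewrite !mulmxA EE.
rewrite sqnormB -dotp_mulmxl -sqnormE.
rewrite [sqnorm (E^T *m _)]sqnormE dotp_mulmxl trmxK EEh -sqnormE; ring.
Qed.

(** Completing the square: [w = A y] is fixed by the projection [E E^T], and the gap is
    [|E^T x - E^T w|^2]. The bound is uniform in [y], which allows coefficients depending on the
    noise. *)
Lemma dotp_span_le (R : realDomainType) N r (E A : 'M[R]_(N, r)) x y :
  E *m E^T *m A = A ->
  2 * dotp x (A *m y) - sqnorm (A *m y) <= sqnorm (E^T *m x).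
Proof.
move=> EA; set w := A *m y.
have wE : w = E *m (E^T *m w) by rewrite mulmxA /w [in RHS]mulmxA EA.
suff -> : 2 * dotp x w - sqnorm w =
    sqnorm (E^T *m x) - sqnorm (E^T *m x - E^T *m w).
  by rewrite gerBl sqnorm_ge0.
rewrite [sqnorm (_ - _)]sqnormB [dotp (E^T *m x) _]dotp_mulmxl trmxK -wE.
by rewrite [sqnorm (E^T *m w)]sqnormE dotp_mulmxl trmxK -wE -sqnormE; ring.
Qed.

(** * Product Bernoulli laws on the finite cube *)

Definition bernoulli_weight (R : pzRingType) N (p : 'I_N -> R)
    (b : {ffun 'I_N -> bool}) : R :=
  \prod_i (if b i then p i else 1 - p i).

Definition noise (R : pzRingType) N (p : 'I_N -> R)
    (b : {ffun 'I_N -> bool}) : 'cV[R]_N :=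
  \col_i ((b i)%:R - p i).

Section BernoulliProduct.
Variables (R : realType) (N : nat) (p : 'I_N -> R).
Hypothesis p01 : forall i, 0 <= p i <= 1.

Lemma bernoulli_weight_ge0 b : 0 <= bernoulli_weight p b.
Proof.
by apply: prodr_ge0 => i _; have /andP[] := p01 i; case: ifP => _; lra.
Qed.

(** Independence in finite form: the product over coordinates distributes over the sums over the two
    values of each bit. *)
Lemma sum_bernoulli_prod (F : 'I_N -> bool -> R) :
  \sum_b bernoulli_weight p b * \prod_i F i (b i) =
  \prod_i (p i * F i true + (1 - p i) * F i false).
Proof.
under [RHS]eq_bigr => i _.
  rewrite (_ : _ + _ = \sum_(x : bool) (if x then p i else 1 - p i) * F i x).
    over.
  by rewrite big_bool.
rewrite bigA_distr_bigA; apply: eq_bigr => b _.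
by rewrite /bernoulli_weight -big_split.
Qed.

Lemma sum_bernoulli_weight : \sum_b bernoulli_weight p b = 1.
Proof.
transitivity (\sum_b bernoulli_weight p b * \prod_(i < N) 1).
  by apply: eq_bigr => b _; rewrite big1// mulr1.
rewrite (sum_bernoulli_prod (fun _ _ => 1)).
by apply: big1 => i _; rewrite !mulr1 addrC subrK.
Qed.

Lemma noise_mgf (c : 'cV[R]_N) :
  \sum_b bernoulli_weight p b * expR (dotp c (noise p b)) <=
  expR (sqnorm c / 8).
Proof.
pose F i x := expR (c i 0 * ((x : bool)%:R - p i)).
rewrite (_ : \sum_b _ = \sum_b bernoulli_weight p b * \prod_i F i (b i)).
  rewrite sum_bernoulli_prod /sqnorm mulr_suml expR_sum.
  apply: ler_prod => i _; have := p01 i => /[dup] /andP[p0 p1] pi01.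
  rewrite addr_ge0 ?mulr_ge0 ?expR_ge0 ?subr_ge0//=.
  have := hoeffding_bernoulli (c i 0) pi01; rewrite /F.
  by rewrite [0 - p i]sub0r mulrN.
apply: eq_bigr => b _; rewrite dotpE expR_sum.
by congr (_ * _); apply: eq_bigr => i _; rewrite mxE.
Qed.

End BernoulliProduct.

(** * Integer grids in place of Gaussian linearization *)

Definition centered (R : pzRingType) (K k : nat) : R :=
  k%:R - K%:R.

(** The centered indices run through the integers from [-K] to [K]. Only the term of the integer [c]
    nearest to [y] matters: [(y - c)^2 <= 1/4] gives [y^2 <= 2 c y - c^2 + 1/4], and
    [exp (1/4) <= 4/3]. *)
Lemma expR_sqr_le_grid (R : realType) (K : nat) (y : R) : `|y| <= K%:R ->
  expR (y ^+ 2) <=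
  4 / 3 * \sum_(k < K.*2.+1)
    expR (2 * (centered R K k * y) - centered R K k ^+ 2).
Proof.
rewrite ler_norml => /andP[Ky yK].
(* Truncating [y + K + 1/2] rounds [y + K] to a nearest integer. *)
have z0 : 0 <= y + K%:R + 1 / 2 by lra.
have /andP[lez ltz] := Num.Theory.truncn_itv z0.
set k := Num.truncn _ in lez ltz.
have kK : (k < K.*2.+1)%N.
  rewrite -(ltr_nat R) (le_lt_trans lez)// -(@natr1 R K.*2) -addnn natrD; lra.
have near : (y - centered R K k) ^+ 2 <= 1 / 4.
  rewrite /centered /=; rewrite -(@natr1 R k) in ltz.
  by set x := (k%:R : R) in lez ltz *; nra.
apply: (@le_trans _ _ (4 / 3 * expR (2 * (centered R K k * y)
                                    - centered R K k ^+ 2))).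
  apply: le_trans (_ : expR (1 / 4) * expR (2 * (centered R K k * y)
                                    - centered R K k ^+ 2) <= _).
    by rewrite -expRD ler_expR; move: (centered _ _ _) near => c; lra.
  by rewrite ler_wpM2r ?expR_ge0// expR_quarter_le.
rewrite ler_wpM2l//.
by rewrite [leRHS](bigD1 (Ordinal kK))//= lerDl sumr_ge0//.
Qed.

(** The terms at [k] and [-k] are each at most [exp (-k/2) <= (2/3)^k]. The right-hand side is 1
    plus twice the sum of [(2/3)^k] for [1 <= k <= K], in closed form. *)
Lemma sum_grid_gaussian_le (R : realType) (K : nat) :
  \sum_(k < K.*2.+1) expR (- (centered R K k ^+ 2 / 2)) <= 5 - 4 * (2 / 3) ^+ K.
Proof.
elim: K => [|K IH].
  rewrite big_ord1 /centered subrr expr0n /= mul0r oppr0 expR0 expr0; lra.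
rewrite doubleS big_ord_recr big_ord_recl /=.
have tail : expR (- (K.+1%:R ^+ 2 / 2)) <= (2 / 3) ^+ K.+1 :> R.
  apply: (@le_trans _ _ (expR (- (1 / 2)) ^+ K.+1)).
    rewrite -expRM_natl ler_expR.
    have : 1 <= K.+1%:R :> R by rewrite ler1n.
    by nra.
  by rewrite lerXn2r ?nnegrE ?expR_ge0// expRN_half_le.
rewrite (eq_bigr (fun k : 'I_K.*2.+1 => expR (- (centered R K k ^+ 2 / 2)))).
  have -> : centered R K.+1 0 = - K.+1%:R by rewrite /centered sub0r.
  have -> : centered R K.+1 K.*2.+2 = K.+1%:R.
    by rewrite /centered -doubleS -addnn natrD addrK.
  rewrite sqrrN.
  by move: tail IH; rewrite [(2 / 3) ^+ K.+1]exprS; lra.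
move=> k _; congr (expR (- (_ ^+ 2 / 2))); rewrite /centered /= /bump /=.
by rewrite add1n -!natr1; ring.
Qed.

Section QuadraticForm.
Variables (R : realType) (N : nat) (p : 'I_N -> R).
Hypothesis p01 : forall i, 0 <= p i <= 1.

(* [exp (y^2)] is dominated by a multiple of
   [\sum_k exp (2 k y - k^2)], which is linear in [y] inside each exponential;
   this replaces the usual linearization by a Gaussian integral. *)
Lemma noise_sqr_mgf r (E : 'M[R]_(N, r)) : E *m E^T *m E = E ->
  \sum_b bernoulli_weight p b * expR (sqnorm (E^T *m noise p b)) <= 7 ^+ r.
Proof.
move=> EE.
(* One [K] serves all outcomes and coordinates, since the noise entries lie in [[-1, 1]]. *)
have [K yK] : exists K, forall b j, `|(E^T *m noise p b) j 0| <= K%:R.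
  pose Y : R := \sum_j \sum_i `|E i j|.
  have Y0 j : \sum_i `|E i j| <= Y.
    rewrite /Y [leRHS](bigD1 j)//= lerDl sumr_ge0// => k _.
    exact: sumr_ge0.
  exists (Num.bound Y) => b j.
  apply/ltW/(le_lt_trans _ (archi_boundP _)); last first.
    by apply: sumr_ge0 => k _; exact: sumr_ge0.
  apply: le_trans (Y0 j); rewrite mxE.
  apply: le_trans (ler_norm_sum _ _ _) _; apply: ler_sum => i _.
  rewrite !mxE normrM ler_piMr//.
  have /andP[p0 p1] := p01 i.
  by case: (b i); rewrite ler_norml; apply/andP; split; rewrite /=; lra.
pose I := {ffun 'I_r -> 'I_K.*2.+1}.
pose grid (g : I) : 'cV[R]_r := \col_j centered R K (g j).
have step b : expR (sqnorm (E^T *m noise p b)) <=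
    (4 / 3) ^+ r * \sum_(g : I) expR (- sqnorm (grid g)) *
                     expR (dotp (2 *: (E *m grid g)) (noise p b)).
  rewrite {1}/sqnorm expR_sum.
  apply: (@le_trans _ _ (\prod_(j < r) (4 / 3 * \sum_(k < K.*2.+1)
     expR (2 * (centered R K k * (E^T *m noise p b) j 0) - centered R K k ^+ 2)))).
    by apply: ler_prod => j _; rewrite expR_ge0 expR_sqr_le_grid.
  rewrite big_split /= prodr_const card_ord bigA_distr_bigA /=.
  rewrite le_eqVlt; apply/orP; left; apply/eqP; congr (_ * _).
  apply: eq_bigr => g _; rewrite -expR_sum -expRD; congr expR.
  rewrite dotpZl dotp_mulmxl dotpE mulr_sumr /sqnorm -sumrN -big_split.
  by apply: eq_bigr => j _; rewrite /= !mxE addrC.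
apply: (@le_trans _ _ ((4 / 3) ^+ r *
    \sum_(g : I) expR (- (sqnorm (grid g) / 2)))).
  apply: (@le_trans _ _ (\sum_b (4 / 3) ^+ r * \sum_(g : I)
     expR (- sqnorm (grid g)) * (bernoulli_weight p b *
       expR (dotp (2 *: (E *m grid g)) (noise p b))))).
    apply: ler_sum => b _; apply: le_trans (ler_wpM2l _ (step b)) _.
      exact: bernoulli_weight_ge0.
    rewrite mulrCA ler_wpM2l ?exprn_ge0//.
    by rewrite mulr_sumr; apply: ler_sum => g _; rewrite mulrCA.
  rewrite -mulr_sumr ler_wpM2l ?exprn_ge0//.
  rewrite exchange_big /=; apply: ler_sum => g _; rewrite -mulr_sumr.
  (* Hoeffding costs [|2 E g|^2 / 8 = |E g|^2 / 2 <= |g|^2 / 2], so half of the exponent [-|g|^2]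
     survives. *)
  apply: le_trans (ler_wpM2l _ (noise_mgf p01 _)) _; first exact: expR_ge0.
  rewrite -expRD ler_expR sqnormZ.
  by have := sqnorm_partial_isometry (grid g) EE; lra.
rewrite (_ : \sum_g _ = \prod_(j < r) \sum_(k < K.*2.+1)
    expR (- (centered R K k ^+ 2 / 2))); last first.
  rewrite bigA_distr_bigA; apply: eq_bigr => g _.
  rewrite -expR_sum /sqnorm mulr_suml -sumrN; congr expR.
  by apply: eq_bigr => j _; rewrite mxE.
rewrite prodr_const card_ord -exprMn lerXn2r ?nnegrE//.
  by rewrite mulr_ge0 ?sumr_ge0// => [|i _]; rewrite ?expR_ge0//; lra.
(* Each coordinate contributes at most [4/3 * 5 = 20/3 < 7]. *)
have := sum_grid_gaussian_le R K.
have : 0 <= (2 / 3) ^+ K :> R by rewrite exprn_ge0//; lra.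
by lra.
Qed.

End QuadraticForm.

(** * Counting models *)

(** With [x = s / X], the binomial formula gives ['C(K, s) x^s <= (1 + x)^K <= exp (K x) <= exp s <=
    3^s]. *)
Lemma bin_mul_expn_le (R : realType) (K s : nat) (X : R) : (0 < s)%N ->
  K%:R <= X -> 0 < X -> 'C(K, s)%:R * (s%:R / X) ^+ s <= 3 ^+ s.
Proof.
move=> s0 KX X0; have x0 : 0 <= s%:R / X by rewrite divr_ge0// ltW.
have [sK|Ks] := leqP s K; last by rewrite bin_small// mul0r exprn_ge0.
apply: (@le_trans _ _ ((1 + s%:R / X) ^+ K)).
  rewrite [leRHS]exprDn (bigD1 (Ordinal (sK : (s < K.+1)%N)))//=.
  rewrite expr1n mul1r mulr_natl lerDl sumr_ge0// => i _.
  by rewrite expr1n mul1r mulrn_wge0// exprn_ge0.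
apply: (@le_trans _ _ (expR (s%:R / X) ^+ K)).
  by rewrite lerXn2r ?nnegrE ?expR_ge0 ?addr_ge0// expR_ge1Dx.
rewrite -expRM_natl (@le_trans _ _ (expR s%:R))// ?ler_expR.
  by rewrite mulrCA ler_piMr// ler_pdivrMr// mul1r.
by rewrite -[s%:R]mulr1 expRM_natl lerXn2r ?nnegrE ?expR_ge0 ?expR1_le3.
Qed.

Lemma expR_mulN_ln (R : realType) k (y : R) : 0 < y ->
  expR (- (k%:R * ln y)) = y ^- k.
Proof. by move=> y0; rewrite expRN expRM_natl lnK. Qed.

(** For [|J| = s] the exponential equals [(s / (25 X))^(2 s)]. One factor [(s / X)^s] absorbs the
    ['C(K, s)] sets of that size, the other is at most 1, and [7^(s+1) <= 49^s]. As
    [3 * 49 / 25^2 <= 1/4], the sum over [s >= 1] is at most 1/3. *)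
Lemma sum_nonempty_subsets_le (R : realType) (K : nat) (X : R) :
  K%:R <= X -> 0 < X ->
  \sum_(J : {set 'I_K} | J != finset.set0)
    7 ^+ #|J|.+1 * expR (- (2 * (#|J|%:R * ln (25 * X / #|J|%:R)))) <= 1 / 3.
Proof.
move=> KX X0.
pose f s : R := 7 ^+ s.+1 * expR (- (2 * (s%:R * ln (25 * X / s%:R)))).
have fle s : (0 < s <= K)%N -> 'C(K, s)%:R * f s <= 4^-1 ^+ s.
  move=> /andP[s0 sK].
  have sr0 : 0 < s%:R :> R by rewrite ltr0n.
  have sX1 : 0 <= s%:R / X <= 1.
    apply/andP; split; first by rewrite divr_ge0 ?ltW.
    by rewrite ler_pdivrMr// mul1r (le_trans _ KX)// ler_nat.
  have -> : f s = 7 ^+ s.+1 * ((s%:R / X) ^+ s * (s%:R / X) ^+ s *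
      (25^-1 ^+ 2) ^+ s).
    rewrite /f (_ : 2 * _ = (2 * s)%N%:R * ln (25 * X / s%:R)); last first.
      by rewrite natrM mulrA.
    rewrite expR_mulN_ln ?divr_gt0 ?mulr_gt0// -!exprMn.
    rewrite exprM -exprVn; congr (_ * _ ^+ s).
    by field; rewrite !gt_eqF.
  have /andP[r0 r1] := sX1.
  have b1 := bin_mul_expn_le s0 KX X0.
  have b2 : (s%:R / X) ^+ s <= 1 by rewrite exprn_ile1.
  have b3 : 7 ^+ s.+1 <= (7 ^+ 2) ^+ s :> R.
    by rewrite -exprM ler_weXn2l ?ler1n//; lia.
  have c0 : 0 <= (25^-1 ^+ 2) ^+ s :> R by rewrite !exprn_ge0.
  have d0 : 0 <= 7 ^+ s.+1 :> R by rewrite exprn_ge0.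
  apply: (@le_trans _ _ (3 ^+ s * ((7 ^+ 2) ^+ s * (25^-1 ^+ 2) ^+ s))).
    have r0' : 0 <= (s%:R / X) ^+ s by rewrite exprn_ge0.
    move: ((25^-1 ^+ 2) ^+ s) c0 (7 ^+ s.+1) d0 ((7 ^+ 2) ^+ s) b3.
    move=> c c0 x x0 y xy.
    move: ((s%:R / X) ^+ s) b1 b2 r0' => z b1 b2 z0.
    rewrite (_ : _ * (x * _) = 'C(K, s)%:R * z * (x * c) * z); last by ring.
    have t0 : 0 <= 'C(K, s)%:R * z * (x * c) by rewrite !mulr_ge0.
    apply: (le_trans (ler_piMr t0 b2)); apply: ler_pM => //.
    - exact: mulr_ge0.
    - exact: mulr_ge0.
    - exact: ler_wpM2r.
  rewrite -!exprMn; apply: lerXn2r; rewrite ?nnegrE ?mulr_ge0 ?exprn_ge0//.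
  lra.
rewrite (partition_big (fun J : {set 'I_K} => inord #|J| : 'I_K.+1)
  (fun s => s != 0)) /=; last first.
  move=> J J0; rewrite -val_eqE /= inordK ?cards_eq0//.
  by rewrite ltnS (leq_trans (max_card _))// card_ord.
apply: (@le_trans _ _ (\sum_(s < K.+1 | s != 0) 4^-1 ^+ s)).
  apply: ler_sum => s s0.
  have s0' : (0 < s <= K)%N by rewrite lt0n -ltnS ltn_ord andbT.
  apply: le_trans (fle _ s0').
  have inJ (J : {set 'I_K}) :
      (J != finset.set0) && (inord #|J| == s) = (#|J| == s).
    rewrite -[inord _ == s]val_eqE /= inordK; last first.
      by rewrite ltnS (leq_trans (max_card _))// card_ord.
    have [Js|] := eqVneq #|J| s; last by rewrite andbF.
    by rewrite -cards_eq0 Js -lt0n (andP s0').1.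
  rewrite (eq_bigl (fun J => J \in [set A : {set 'I_K} | #|A| == s]%SET)).
    rewrite (eq_bigr (fun=> f s)) => [|J]; last by rewrite inE /f => /eqP ->.
    by rewrite sumr_const card_draws card_ord mulr_natl.
  by move=> J; rewrite inE inJ.
rewrite big_mkcond big_ord_recl /= add0r.
have : forall k, \sum_(i < k) 4^-1 ^+ i.+1 <= 1 / 3 - 1 / 3 * 4^-1 ^+ k :> R.
  elim=> [|k IH]; first by rewrite big_ord0 expr0; lra.
  by rewrite big_ord_recr /= exprS; lra.
move=> /(_ K); rewrite (eq_bigr (fun i : 'I_K => 4^-1 ^+ i.+1))//.
have : 0 <= 4^-1 ^+ K :> R by rewrite exprn_ge0.
by lra.
Qed.

(** * Counting sequences with few switches *)

Section Switches.
Variables (R : realType) (n m : nat).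
Local Notation T := {ffun 'I_n -> 'I_m.+1}.

Definition few_changes n0 (t : T) := (#|[pred i | t i != 0%R]| <= n0)%N.

(** Exponential weighting: for [0 < x <= 1] the indicator is at most [x^(-n0)] times [x] to the
    number of nonzero entries, and the sum of these weights factorizes over the nodes. *)
Lemma sum_few_changes_le n0 : (0 < n)%N -> (n0 <= n)%N ->
  \sum_(t : T) (few_changes n0 t)%:R <=
  expR (n0%:R * ln (m.+1%:R * n%:R * expR 1 / n0%:R)) :> R.
Proof.
(* For [n0 = 0] only the zero map remains, and the bound reads [expR 0]. *)
move=> n_gt0; case: n0 => [|n0] n0n.
  rewrite mul0r expR0 (bigD1 ([ffun=> 0] : T))//= big1 ?addr0 => [|t t0].
    by case: few_changes.
  rewrite (_ : few_changes 0 t = false)//.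
  apply/negP; rewrite /few_changes leqn0 => /eqP/card0_eq h.
  case/eqP: t0; apply/ffunP => i; rewrite ffunE.
  by apply/eqP; have := h i; rewrite inE => /negbFE.
set k := n0.+1 in n0n *.
(* This choice makes [(1 + x (m + 1))^n <= exp (x (m + 1) n) = exp k]. *)
pose x : R := k%:R / (m.+1%:R * n%:R).
have mn0 : 0 < m.+1%:R * n%:R :> R by rewrite mulr_gt0// ltr0n.
have x0 : 0 < x by rewrite divr_gt0// ltr0n.
have x1 : x <= 1.
  by rewrite ler_pdivrMr// mul1r -natrM ler_nat (leq_trans n0n)// leq_pmull.
have -> : m.+1%:R * n%:R * expR 1 / k%:R = x^-1 * expR 1 :> R.
  by rewrite /x invf_div; ring.
have -> : expR (k%:R * ln (x^-1 * expR 1)) = x ^- k * expR 1 ^+ k.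
  rewrite -[RHS]invrK -exprVn -exprMn -[X in _ = X]invrK -exprVn.
  rewrite expRM_natl lnK ?posrE ?mulr_gt0 ?invr_gt0 ?expR_gt0//.
  by rewrite !exprVn !invrK.
apply: (@le_trans _ _ (\sum_(t : T) x ^- k *
    \prod_i (if t i != 0 then x else 1))).
  apply: ler_sum => t _.
  rewrite -big_mkcond /= prodr_const.
  have h : 0 <= x ^- k * x ^+ #|[pred i | t i != 0]|.
    by rewrite mulr_ge0 ?invr_ge0 ?exprn_ge0// ltW.
  case ft : few_changes => //=.
  rewrite mulrC ler_pdivlMr ?exprn_gt0// mul1r.
  by apply: ler_wiXn2l => //; rewrite ltW.
rewrite -mulr_sumr ler_wpM2l ?invr_ge0 ?exprn_ge0 ?(ltW x0)//.
rewrite -(bigA_distr_bigA (fun _ (c : 'I_m.+1) => if c != 0 then x else 1)).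
rewrite prodr_const card_ord (bigD1 0)//=.
rewrite (eq_bigr (fun _ => x)) => [|i ->//].
rewrite sumr_const -mulr_natr.
apply: (@le_trans _ _ (expR (x * m.+1%:R) ^+ n)).
  rewrite lerXn2r ?nnegrE ?expR_ge0 ?addr_ge0 ?mulr_ge0 ?(ltW x0)//.
  apply: le_trans (expR_ge1Dx _); rewrite lerD2l ler_wpM2l ?(ltW x0)//.
  by rewrite ler_nat (leq_trans (max_card _))// card_ord.
rewrite -!expRM_natl mulr1 ler_expR /x.
rewrite le_eqVlt; apply/orP; left; apply/eqP; field.
by rewrite pnatr_eq0 -lt0n n_gt0 nat1r pnatr_eq0.
Qed.

(** Time 0 is unconstrained because its increment is the initial labelling. *)
Definition sparse_increments n0 L (h : {ffun 'I_L -> T}) :=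
  [forall l : 'I_L, (l == 0 :> nat) || few_changes n0 (h l)].

(** The condition factorizes over time: [(m + 1)^n] free labellings at time 0, then [L - 1]
    increments with few nonzero entries. *)
Lemma card_sparse_increments_le n0 L : (0 < n)%N -> (n0 <= n)%N -> (0 < L)%N ->
  #|[pred h : {ffun 'I_L -> T} | sparse_increments n0 h]|%:R <=
  m.+1%:R ^+ n *
  expR (n0%:R * (L%:R - 1) * ln (m.+1%:R * n%:R * expR 1 / n0%:R)) :> R.
Proof.
move=> n_gt0 n0n; case: L => // L _.
pose F (l : 'I_L.+1) (t : T) : R := ((l == 0 :> nat) || few_changes n0 t)%:R.
rewrite -sum1_card natr_sum (_ : \sum_(i in _) _ =
    \sum_(h : {ffun 'I_L.+1 -> T}) \prod_l F l (h l)).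
  rewrite -bigA_distr_bigA big_ord_recl /F /= sumr_const card_ffun !card_ord.
  rewrite natrX ler_wpM2l ?exprn_ge0//.
  rewrite (eq_bigr (fun=> \sum_(t : T) (few_changes n0 t)%:R))//.
  rewrite prodr_const card_ord.
  apply: le_trans (_ : expR _ ^+ L <= _).
    apply: lerXn2r (sum_few_changes_le n_gt0 n0n); rewrite ?nnegrE ?expR_ge0//.
    by apply: sumr_ge0 => t _; rewrite ler0n.
  by rewrite -expRM_natl -(@natr1 R L) addrK mulrA [L%:R * _]mulrC.
rewrite big_mkcond /=; apply: eq_bigr => h _.
rewrite inE /sparse_increments.
case: forallP => [hh|hh].
  by rewrite big1// => l _; rewrite /F hh.
have [l hl] : exists l : 'I_L.+1, ~~ ((l == 0 :> nat) || few_changes n0 (h l)).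
  by apply/existsP; rewrite -negb_forall; apply/negP => /forallP.
by rewrite (bigD1 l)//= /F (negbTE hl) mul0r.
Qed.

End Switches.

(** Telescoping, from [1 / (k + 1)^2 <= 1 / k - 1 / (k + 1)]. *)
Lemma sum_inv_sqr_le2 (R : realFieldType) k :
  \sum_(m < k) m.+1%:R ^- 2 <= 2 :> R.
Proof.
case: k => [|k]; first by rewrite big_ord0.
suff : \sum_(m < k.+1) m.+1%:R ^- 2 <= 2 - k.+1%:R^-1 :> R.
  by move=> h; apply: (le_trans h); rewrite gerBl invr_ge0.
elim: k => [|k IH]; first by rewrite big_ord1 invr1 expr1n invr1; lra.
rewrite big_ord_recr /=; apply: (le_trans (lerD IH (lexx _))).
suff : k.+2%:R ^- 2 <= k.+1%:R^-1 - k.+2%:R^-1 :> R.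
  by move: (_ ^- 2) (k.+1%:R^-1) (k.+2%:R^-1) => a b c; lra.
rewrite -(@natr1 R k.+1); move: (k.+1%:R : R) (ltr0Sn R k) => x x0.
have x1 : 0 < x + 1 by lra.
rewrite (_ : x^-1 - (x + 1)^-1 = (x * (x + 1))^-1); last first.
  by field; rewrite !gt_eqF.
by rewrite lef_pV2 ?posrE ?exprn_gt0 ?mulr_gt0//; nra.
Qed.

Lemma Mdim_le m : (Mdim m <= m ^ 2)%N.
Proof. by rewrite MdimE; nia. Qed.

(** * Summing exponentials of the penalty over all models *)

Section Penalty.
Variables (R : realType) (n n0 L : nat).
Hypotheses (n_gt0 : (0 < n)%N) (n0n : (n0 <= n)%N) (L_gt0 : (0 < L)%N).

Lemma switch_term_ge0 m : (0 < m)%N ->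
  0 <= n0%:R * (L%:R - 1) * ln (m%:R * n%:R * expR 1 / n0%:R) :> R.
Proof.
move=> m0; have [->|n00] := posnP n0; first by rewrite mul0r mul0r.
rewrite !mulr_ge0 ?subr_ge0 ?ler1n// ln_ge0// ler_pdivlMr ?ltr0n// mul1r.
apply: (@le_trans _ _ (m%:R * n%:R)).
  by rewrite -natrM ler_nat (leq_trans n0n)// leq_pmull.
by rewrite ler_peMr ?mulr_ge0// (le_trans _ (expR_ge1Dx _))// lerDl.
Qed.

Lemma sparsity_term_ge0 s m : (0 < s <= L * Mdim m)%N ->
  0 <= s%:R * ln (25 * m%:R ^+ 2 * L%:R / s%:R) :> R.
Proof.
move=> /andP[s0 sK]; rewrite mulr_ge0// ln_ge0// ler_pdivlMr ?ltr0n// mul1r.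
rewrite -natrX -!natrM ler_nat; have := Mdim_le m; move: sK.
move: (Mdim m) => M; nia.
Qed.

Lemma Pen_ge0 s m : (0 < m)%N -> (0 < s <= L * Mdim m)%N ->
  0 <= Pen R n n0 L s m.
Proof.
move=> m0 sK; rewrite /Pen mulr_ge0// !addr_ge0//.
- by rewrite mulr_ge0// ln_ge0// ler1n.
- exact: switch_term_ge0.
- by rewrite mulrAC mulr_ge0// sparsity_term_ge0.
Qed.

(** Half of the penalty carries the factors 11/2, 11/2 and 11/4, enough for [3 A + B] and twice the
    sparsity exponent, since all terms are nonnegative. One [A] and the [B] pay for the number of
    clustering sequences, the other [2 A] leave the summable [(m + 1)^(-2)], and the sparsity part
    sums to at most 1/3. *)
Lemma sum_models_Pen_le m :
  \sum_(h : {ffun 'I_L -> {ffun 'I_n -> 'I_m.+1}} | sparse_increments n0 h)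
   \sum_(J : {set 'I_(L * Mdim m.+1)} | J != finset.set0)
     7 ^+ #|J|.+1 * expR (- (Pen R n n0 L #|J| m.+1 / 2)) <=
  1 / 3 * m.+1%:R ^- 2.
Proof.
set A : R := n%:R * ln m.+1%:R.
set B : R := n0%:R * (L%:R - 1) * ln (m.+1%:R * n%:R * expR 1 / n0%:R).
have A0 : 0 <= A by rewrite mulr_ge0// ln_ge0// ler1n.
have B0 : 0 <= B by exact: switch_term_ge0.
pose X : R := m.+1%:R ^+ 2 * L%:R.
have X0 : 0 < X by rewrite mulr_gt0 ?exprn_gt0// ltr0n.
have KX : (L * Mdim m.+1)%:R <= X.
  by rewrite /X -natrX -natrM ler_nat mulnC leq_mul// Mdim_le.
apply: (@le_trans _ _ (\sum_(h : {ffun 'I_L -> {ffun 'I_n -> 'I_m.+1}} |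
    sparse_increments n0 h) (expR (- (3 * A + B)) * (1 / 3)))).
  apply: ler_sum => h _.
  apply: le_trans (ler_wpM2l (expR_ge0 _) (sum_nonempty_subsets_le KX X0)).
  rewrite mulr_sumr; apply: ler_sum => J J0.
  rewrite mulrCA ler_wpM2l ?exprn_ge0// -expRD ler_expR.
  have := @sparsity_term_ge0 #|J| m.+1.
  rewrite card_gt0 J0 (leq_trans (max_card _)) ?card_ord// => /(_ isT).
  rewrite /Pen -/A -/B /X [25 * (_ * _)]mulrA.
  by move: (ln _) => l; move: (#|J|%:R : R) => s; lra.
rewrite sumr_const -[_ *+ #|_|]mulr_natr mulrAC [leRHS]mulrC ler_wpM2r//.
rewrite mulrC.
apply: le_trans (ler_wpM2r (expR_ge0 _)
  (card_sparse_increments_le R m n_gt0 n0n L_gt0)) _.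
rewrite -/B -mulrA -expRD (_ : B - _ = - (3 * A)); last by ring.
rewrite (_ : 3 * A = (3 * n)%N%:R * ln m.+1%:R); last first.
  by rewrite natrM /A mulrA.
rewrite expR_mulN_ln// -ler_pdivlMl ?exprn_gt0//.
rewrite -invfM -exprD lef_pV2 ?posrE ?exprn_gt0//.
by rewrite ler_weXn2l ?ler1n//; lia.
Qed.

End Penalty.

(* A sequence of clustering matrices is encoded by the increments in [Z/mZ] of
   the class labels, so that switches become nonzero entries. *)
Definition class_of n m L (h : {ffun 'I_L -> {ffun 'I_n -> 'I_m.+1}})
    (l : 'I_L) i : 'I_m.+1 :=
  \sum_(l' : 'I_L | (l' <= l)%N) h l' i.

Definition clustering_of n m L (h : {ffun 'I_L -> {ffun 'I_n -> 'I_m.+1}})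
    (l : 'I_L) : 'M[bool]_(n, m.+1) :=
  \matrix_(i, k) (class_of h l i == k).

Lemma clustering_label n m (Z : 'M[bool]_(n, m)) : is_clustering Z ->
  exists f : 'I_n -> 'I_m, forall i k, Z i k = (f i == k).
Proof.
move=> Zc; have Zex i : exists k, Z i k.
  have /card1P[k kP] : #|[pred k | Z i k]| == 1%N by rewrite Zc.
  by exists k; have := kP k; rewrite !inE eqxx.
have Zuniq i k k' : Z i k -> Z i k' -> k = k'.
  move=> Zk Zk'; have /card1P[k0 kP] : #|[pred k | Z i k]| == 1%N by rewrite Zc.
  have := kP k; have := kP k'; rewrite !inE Zk Zk'.
  by move=> /esym/eqP -> /esym/eqP ->.
exists (fun i => xchoose (Zex i)) => i k.
apply/idP/eqP => [Zk|<-]; last exact: xchooseP.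
by apply: Zuniq Zk; exact: xchooseP.
Qed.

(** Successive differences of the labels form [h]: a node that keeps its class has increment 0, and
    the partial sums telescope back to the labels. Hence a sum over sparse [h] covers every
    admissible sequence. *)
Lemma clustering_of_surj n m L n0 (Z : 'I_L -> 'M[bool]_(n, m.+1)) :
  (forall l, is_clustering (Z l)) ->
  (forall l l' : 'I_L, l' = l.+1 :> nat -> (n_switches (Z l) (Z l') <= n0)%N) ->
  exists2 h, sparse_increments n0 h & Z = clustering_of h.
Proof.
move=> Zc Zs.
have /choice [f fE] l := clustering_label (Zc l).
case: L Z Zc Zs f fE => [|L] Z Zc Zs f fE.
  exists [ffun=> [ffun=> 0]]; first by apply/forallP => -[].
  by apply/funext => -[].
pose pre (l : 'I_L.+1) : 'I_L.+1 := inord l.-1.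
pose h : {ffun 'I_L.+1 -> {ffun 'I_n -> 'I_m.+1}} := [ffun l : 'I_L.+1 =>
  [ffun i => if l == 0 :> nat then f l i else f l i - f (pre l) i]].
exists h.
  apply/forallP => l; have [//|l0 /=] := eqVneq (l : nat) 0%N.
  have ll : l = (pre l).+1 :> nat.
    rewrite inordK; first by rewrite prednK ?lt0n.
    exact: leq_ltn_trans (leq_pred _) (ltn_ord l).
  apply: leq_trans (Zs _ _ ll); apply: subset_leq_card.
  apply/fintype.subsetP => i; rewrite !inE !ffunE (negbTE l0) subr_eq0.
  apply: contra => /eqP /matrixP /(_ 0 (f l i)).
  by rewrite !mxE !fE eqxx => /eqP ->.
suff fh l i : class_of h l i = f l i.
  by apply/funext => l; apply/matrixP => i k; rewrite mxE fh fE.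
rewrite /class_of; case: l => l lL; elim: l lL => [|l IH] lL.
  rewrite (bigD1 (Ordinal lL))//= !ffunE /= big1 ?addr0// => l.
  by rewrite leqn0 -val_eqE /= => /andP[/eqP ->].
rewrite (bigD1 (Ordinal lL))//= !ffunE /=.
rewrite (eq_bigl (fun l' : 'I_L.+1 => (l' <= l)%N)).
  rewrite (IH (ltnW lL)) (_ : pre _ = Ordinal (ltnW lL)) ?subrK//.
  by apply: val_inj; rewrite /= inordK//= ltnW.
by move=> l'; rewrite -val_eqE /= -[RHS]ltnS [RHS]ltn_neqAle andbC.
Qed.

(** * The oracle inequality *)

Lemma ler_sum_term (R : numDomainType) (I : finType) (P : pred I) (F : I -> R)
    i :
  P i -> (forall j, 0 <= F j) -> F i <= \sum_(j | P j) F j.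
Proof.
by move=> Pi F0; rewrite (bigD1 i)//= lerDl; apply: sumr_ge0 => j _; exact: F0.
Qed.

Lemma exchange_bernoulli_sum (R : realType) N (p : 'I_N -> R)
    (I : Type) (r : seq I) (P : pred I) (F : I -> {ffun 'I_N -> bool} -> R) :
  \sum_b bernoulli_weight p b * (\sum_(i <- r | P i) F i b) =
  \sum_(i <- r | P i) \sum_b bernoulli_weight p b * F i b.
Proof. by rewrite exchange_big; apply: eq_bigr => b _; rewrite mulr_sumr. Qed.

Section OracleInequality.
Variables (R : realType) (n n0 L : nat) (H : 'M[R]_L).
Variable theta : 'cV[R]_(L * Ndim n).
Hypotheses (n_gt0 : (0 < n)%N) (n0n : (n0 <= n)%N) (L_gt0 : (0 < L)%N).
Hypothesis theta01 : forall r, 0 <= theta r 0 <= 1.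

Let p r := theta r 0.

Definition design m (Z : 'I_L -> 'M[bool]_(n, m)) :
    'M[R]_(L * Ndim n, L * Mdim m) :=
  block_diagonal (fun l => clustering_mx R (Z l)) *m
    (transform_mx H (Mdim m))^T.

(* The fits of a model together with [theta] span at most [|J| + 1]
   dimensions. *)
Definition model_span m (Z : 'I_L -> 'M[bool]_(n, m))
    (J : {set 'I_(L * Mdim m)}) : 'M[R]_(L * Ndim n, 1 + #|J|) :=
  row_mx theta (colsub enum_val (design Z)).

Definition model_basis m (Z : 'I_L -> 'M[bool]_(n, m))
    (J : {set 'I_(L * Mdim m)}) : 'M[R]_(L * Ndim n, 1 + #|J|) :=
  sval (cid (gram_schmidt (model_span Z J))).

Definition excess m (Z : 'I_L -> 'M[bool]_(n, m)) (J : {set 'I_(L * Mdim m)})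
    b : R :=
  sqnorm ((model_basis Z J)^T *m noise p b) - Pen R n n0 L #|J| m / 2.

(** The index [m] stands for [m + 1] classes, so that labels live in the group ['I_m.+1]. *)
Definition class_number_term m b : R :=
  \sum_(h : {ffun 'I_L -> {ffun 'I_n -> 'I_m.+1}} | sparse_increments n0 h)
   \sum_(J : {set 'I_(L * Mdim m.+1)} | J != finset.set0)
     expR (excess (clustering_of h) J b).

(** The leading 1 keeps the logarithm nonnegative, the second term controls the cross term of the
    oracle, and the last one controls all models at once. *)
Definition fluctuation (v : 'cV[R]_(L * Ndim n)) b : R :=
  1 + expR (dotp (- 2 *: v) (noise p b) - sqnorm v / 2) +
  \sum_(m < n) class_number_term m b.

Lemma class_number_term_ge0 m b : 0 <= class_number_term m b.
Proof.
by apply: sumr_ge0 => h _; apply: sumr_ge0 => J _; exact: expR_ge0.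
Qed.

Lemma fluctuation_ge1 v b : 1 <= fluctuation v b.
Proof.
rewrite /fluctuation -addrA lerDl addr_ge0 ?expR_ge0//.
by apply: sumr_ge0 => m _; exact: class_number_term_ge0.
Qed.

(** The three parts have means at most 1, 1 and 2/3. For the second, Hoeffding applied to [-2 v]
    gives exactly the exponent [|v|^2 / 2] that is subtracted; for the third, each model contributes
    at most [7^(|J| + 1)] times [exp (- Pen / 2)]. *)
Lemma mean_fluctuation_le v :
  \sum_b bernoulli_weight p b * fluctuation v b <= 9.
Proof.
rewrite (eq_bigr (fun b => bernoulli_weight p b +
    expR (- (sqnorm v / 2)) *
      (bernoulli_weight p b * expR (dotp (- 2 *: v) (noise p b))) +
    bernoulli_weight p b * \sum_(m < n) class_number_term m b)); last first.
  by move=> b _; rewrite /fluctuation !mulrDr mulr1 expRD; ring.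
rewrite !big_split /= sum_bernoulli_weight -mulr_sumr.
have A : expR (- (sqnorm v / 2)) *
    (\sum_b bernoulli_weight p b * expR (dotp (- 2 *: v) (noise p b))) <= 1.
  apply: le_trans (ler_wpM2l (expR_ge0 _) (noise_mgf theta01 _)) _.
  by rewrite -expRD sqnormZ -[leRHS]expR0 ler_expR; lra.
suff C : \sum_b bernoulli_weight p b *
    \sum_(m < n) class_number_term m b <= 1 / 3 * 2 by lra.
rewrite exchange_bernoulli_sum.
apply: le_trans (ler_wpM2l _ (sum_inv_sqr_le2 R n)); last by [].
rewrite mulr_sumr; apply: ler_sum => m _.
apply: le_trans (sum_models_Pen_le R n_gt0 n0n L_gt0 m).
rewrite exchange_bernoulli_sum; apply: ler_sum => h _.
rewrite exchange_bernoulli_sum; apply: ler_sum => J _.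
have [_ EE] := svalP (cid (gram_schmidt (model_span (clustering_of h) J))).
apply: le_trans (ler_wpM2r (expR_ge0 _) (noise_sqr_mgf theta01 EE)).
rewrite mulr_suml; apply: ler_sum => b _.
by rewrite /excess expRD mulrA.
Qed.

(** The coefficient of the column [theta] is -1, and columns outside [J] carry zero coefficients. *)
Lemma fitted_in_span (c : candidate R n L) :
  (forall j, j \notin cand_J c -> cand_d c j 0 = 0) ->
  exists y, fitted H c - theta = model_span (cand_Z c) (cand_J c) *m y.
Proof.
move=> dJ; exists (col_mx (-1)%:M (\col_k cand_d c (enum_val k) 0)).
rewrite /model_span mul_row_col mul_mx_scalar scaleN1r addrC; congr (_ + _).
apply/colP => r; rewrite /fitted -/(design _) !mxE.
rewrite (bigID (mem (cand_J c))) /= [X in _ + X]big1 ?addr0 => [|j jJ].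
  by rewrite big_enum_val; apply: eq_bigr => k _; rewrite !mxE.
by rewrite dJ// mulr0.
Qed.

(** All terms of [fluctuation] are nonnegative, so whichever model the data select, its own term is
    bounded by the whole sum. *)
Lemma expR_excess_le m (Z : 'I_L -> 'M[bool]_(n, m))
    (J : {set 'I_(L * Mdim m)}) v b : (1 <= m <= n)%N ->
  (forall l, is_clustering (Z l)) ->
  (forall l l' : 'I_L, l' = l.+1 :> nat -> (n_switches (Z l) (Z l') <= n0)%N) ->
  J != finset.set0 -> expR (excess Z J b) <= fluctuation v b.
Proof.
case: m Z J => // m Z J mn Zc Zs J0.
have [h hs ->] := clustering_of_surj Zc Zs.
pose F h' J' := expR (excess (clustering_of (h' :
  {ffun 'I_L -> {ffun 'I_n -> 'I_m.+1}})) J' b).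
have F0 h' J' : 0 <= F h' J' by exact: expR_ge0.
have le1 : F h J <= class_number_term m b.
  apply: (le_trans (ler_sum_term (P := fun J' => J' != finset.set0)
    J0 (F0 h))).
  apply: (ler_sum_term (P := @sparse_increments n m n0 L) (F := fun h' =>
    \sum_(J' : {set 'I_(L * Mdim m.+1)} | J' != finset.set0) F h' J')) hs _.
  by move=> h'; apply: sumr_ge0 => J' _; exact: F0.
apply: (le_trans le1); rewrite /fluctuation.
rewrite [X in _ + X](bigD1 (Ordinal (mn : (m < n)%N)))//= [leRHS]addrCA lerDl.
have e0 u : 0 <= 1 + expR u :> R by rewrite addr_ge0 ?expR_ge0.
apply: addr_ge0 (e0 _) _.
by apply: sumr_ge0 => m' _; exact: class_number_term_ge0.
Qed.

Lemma oracle_inequality alpha1 alpha2 b (c c0 : candidate R n L) :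
  feasible n0 alpha1 alpha2 c ->
  objective n0 H (theta + noise p b) c <=
    objective n0 H (theta + noise p b) c0 ->
  sqnorm (fitted H c - theta) <=
    3 * sqnorm (fitted H c0 - theta) + 2 * Pen R n n0 L #|cand_J c0| (cand_m c0)
    + 19 * ln (fluctuation (fitted H c0 - theta) b).
Proof.
move=> [mc Jc dc [Zc Zs _]]; rewrite /objective.
set v := fitted H c0 - theta; set x := fitted H c - theta.
set xi := noise p b; set Psi := fluctuation v b.
have [y xy] := fitted_in_span dc.
have Psi_gt0 : 0 < Psi by exact: lt_le_trans (fluctuation_ge1 v b).
have lnPsi0 : 0 <= ln Psi by rewrite ln_ge0// fluctuation_ge1.
have lnPsi1 : dotp (- 2 *: v) xi - sqnorm v / 2 <= ln Psi.
  rewrite -ler_expR lnK// /Psi /fluctuation -addrA addrCA lerDl addr_ge0//.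
  by apply: sumr_ge0 => m _; exact: class_number_term_ge0.
have lnPsi2 : excess (cand_Z c) (cand_J c) b <= ln Psi.
  rewrite -ler_expR lnK//.
  exact: expR_excess_le.
(* The factor 1/2 turns this into [2 xi.x <= |x|^2 / 2 + 2 |Pi xi|^2], so that half of [|x|^2] is
   absorbed on the left. *)
have quad : 2 * dotp xi (2^-1 *: x) - sqnorm (2^-1 *: x) <=
    sqnorm ((model_basis (cand_Z c) (cand_J c))^T *m xi).
  have [EA _] := svalP (cid (gram_schmidt (model_span (cand_Z c) (cand_J c)))).
  by rewrite /x xy scalemxAr; apply: dotp_span_le.
have -> : theta + xi - fitted H c = xi - x by rewrite /x opprB addrCA addrA.
have -> : theta + xi - fitted H c0 = xi - v by rewrite /v opprB addrCA addrA.
rewrite (sqnormB xi x) (sqnormB xi v).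
(* After doubling, the excess enters with weight 4 and the oracle exponent with weight 2, hence
   [6 ln Psi]; 19 suffices because [ln Psi >= 0]. *)
move: quad lnPsi2 lnPsi1; rewrite /excess -/xi dotpZl [dotp xi (_ *: _)]dotpC.
rewrite dotpZl [dotp x _]dotpC [dotp v _]dotpC !sqnormZ; lra.
Qed.

End OracleInequality.

(** * Vectorization and the approximation error *)

Lemma sum_mxtens (R : nmodType) m n (F : 'I_(m * n) -> R) :
  \sum_r F r = \sum_i \sum_j F (mxtens_index (i, j)).
Proof.
rewrite pair_big /= (reindex (@mxtens_index m n)) /=.
  by apply: eq_bigr => -[].
by exists (@mxtens_unindex m n) => i; rewrite (mxtens_indexK, mxtens_unindexK).
Qed.

Lemma stackE (R : Type) L K (v : 'I_L -> 'cV[R]_K) l k z :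
  stack v (mxtens_index (l, k)) z = v l k ord0.
Proof. by rewrite mxE mxtens_indexK. Qed.

Lemma block_diagonalE (R : pzRingType) L N M (A : 'I_L -> 'M[R]_(N, M))
    l i l' j :
  block_diagonal A (mxtens_index (l, i)) (mxtens_index (l', j)) =
  (l == l')%:R * A l i j.
Proof.
rewrite summxE (bigD1 l)//= big1 ?addr0 => [|k kl].
  by rewrite tensmxE mxE eqxx [l' == l]eq_sym.
by rewrite tensmxE mxE [l == k]eq_sym (negbTE kl) mul0r.
Qed.

Lemma block_diagonal_mulE (R : pzRingType) L N M (A : 'I_L -> 'M[R]_(N, M))
    (u : 'cV_(L * M)) l i z :
  (block_diagonal A *m u) (mxtens_index (l, i)) z =
  \sum_j A l i j * u (mxtens_index (l, j)) z.
Proof.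
rewrite mxE sum_mxtens (bigD1 l)//= [X in _ + X]big1 ?addr0 => [|k kl].
  by apply: eq_bigr => j _; rewrite block_diagonalE eqxx mul1r.
by apply: big1 => j _; rewrite block_diagonalE eq_sym (negbTE kl) !mul0r.
Qed.

Lemma tensmx1 (R : pzRingType) m n :
  (1%:M : 'M[R]_m) *t (1%:M : 'M[R]_n) = 1%:M.
Proof.
apply/matrixP => i j.
case: (mxtens_indexP i) => i1 i2; case: (mxtens_indexP j) => j1 j2.
rewrite tensmxE !mxE -natrM mulnb -xpair_eqE.
by rewrite (can_eq (@mxtens_indexK m n)).
Qed.

(** * Orthogonality of the coefficient transform *)

Section Transform.
Variables (R : comPzRingType) (L M : nat) (H : 'M[R]_L).
Hypothesis HH : H *m H^T = 1%:M.

Lemma transform_mxK : transform_mx H M *m (transform_mx H M)^T = 1%:M.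
Proof.
by rewrite /transform_mx trmx_tens tensmx_mul HH trmx1 mul1mx tensmx1.
Qed.

Lemma transform_stack (Q : 'M[R]_(M, L)) :
  transform_mx H M *m stack (fun l => col l Q) =
  stack (fun l => col l (Q *m H^T)).
Proof.
apply/colP => r; case: (mxtens_indexP r) => l k.
rewrite stackE !mxE sum_mxtens; apply: eq_bigr => l' _.
rewrite (bigD1 k)//= big1 ?addr0 => [|k' kk'].
  by rewrite tensmxE stackE !mxE eqxx mulr1 mulrC.
by rewrite tensmxE !mxE eq_sym (negbTE kk') mulr0 mul0r.
Qed.

End Transform.

(** A one-sided inverse of a square matrix is two-sided, so the transpose recovers [Q] from
    [Q H^T]. *)
Lemma transform_tr_stack (R : comUnitRingType) L M (H : 'M[R]_L)
    (Q : 'M[R]_(M, L)) : H *m H^T = 1%:M ->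
  (transform_mx H M)^T *m stack (fun l => col l (Q *m H^T)) =
  stack (fun l => col l Q).
Proof.
move=> HH; rewrite -transform_stack mulmxA.
by rewrite (mulmx1C (transform_mxK _ HH)) mul1mx.
Qed.

Lemma sqnorm_transform_tr (R : comPzRingType) L M (H : 'M[R]_L)
    (u : 'cV[R]_(L * M)) : H *m H^T = 1%:M ->
  sqnorm ((transform_mx H M)^T *m u) = sqnorm u.
Proof.
move=> HH; rewrite sqnormE dotp_mulmxl trmxK mulmxA transform_mxK// mul1mx.
by rewrite -sqnormE.
Qed.

(** * Sums over unordered pairs *)

Lemma sum_sig (R : nmodType) (T : finType) (P : pred T) (F : T -> R) :
  \sum_(x | P x) F x = \sum_(y : {x | P x}) F (val y).
Proof.
rewrite (reindex_omap (val : {x | P x} -> T) insub) => [|x Px].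
  by apply: eq_bigl => y; rewrite (valP y) valK eqxx.
by rewrite insubT.
Qed.

Lemma sum_enum_val (R : nmodType) (T : finType) (F : T -> R) :
  \sum_x F x = \sum_(r < #|{: T}|) F (enum_val r).
Proof. by rewrite -big_enum_val. Qed.

Section SymmetricSums.
Variables (R : comPzRingType).

Lemma sum_node_pairs n (f : 'I_n -> 'I_n -> R) : (forall i j, f i j = f j i) ->
  \sum_i \sum_j f i j =
  \sum_i f i i + 2 * \sum_(r < Ndim n) f (node1 r) (node2 r).
Proof.
move=> fC; pose g (p : 'I_n * 'I_n) := f p.1 p.2.
have -> : \sum_(r < Ndim n) f (node1 r) (node2 r) =
    \sum_(p : 'I_n * 'I_n | (p.1 < p.2)%N) g p.
  by rewrite [RHS]sum_sig [RHS]sum_enum_val.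
have -> : \sum_i \sum_j f i j = \sum_p g p by rewrite pair_big.
rewrite (bigID (fun p : 'I_n * 'I_n => p.1 == p.2)) /=; congr (_ + _).
  rewrite (reindex_onto (fun i => (i, i)) fst) => [|[i j] /= /eqP ->//].
  by apply: eq_bigl => i; rewrite /= !eqxx.
rewrite (bigID (fun p : 'I_n * 'I_n => (p.1 < p.2)%N)) /= mulr_natl mulr2n.
congr (_ + _).
  by apply: eq_bigl => -[i j] /=; rewrite -val_eqE; case: ltngtP.
rewrite (reindex_inj (h := fun p : 'I_n * 'I_n => (p.2, p.1))) /=.
  apply: eq_big => -[i j] /=; first by rewrite -val_eqE; case: ltngtP.
  by rewrite /g fC.
by move=> [i j] [i' j'] [-> ->].
Qed.

End SymmetricSums.

(** Only an inequality, because the right-hand side counts the diagonal pairs twice. *)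
Lemma sum_class_pairs_le (R : numDomainType) m (f : 'I_m -> 'I_m -> R) :
  (forall i j, f i j = f j i) -> (forall i j, 0 <= f i j) ->
  \sum_i \sum_j f i j <= 2 * \sum_(c < Mdim m) f (class1 c) (class2 c).
Proof.
move=> fC f0; pose g (p : 'I_m * 'I_m) := f p.1 p.2.
have -> : \sum_(c < Mdim m) f (class1 c) (class2 c) =
    \sum_(p : 'I_m * 'I_m | (p.1 <= p.2)%N) g p.
  by rewrite [RHS]sum_sig [RHS]sum_enum_val.
have -> : \sum_i \sum_j f i j = \sum_p g p by rewrite pair_big.
rewrite (bigID (fun p : 'I_m * 'I_m => (p.1 <= p.2)%N)) /= mulr_natl mulr2n.
rewrite lerD2l (reindex_inj (h := fun p : 'I_m * 'I_m => (p.2, p.1))) /=;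
  last first.
  by move=> [i j] [i' j'] [-> ->].
rewrite [leRHS](bigID (fun p : 'I_m * 'I_m => p.1 == p.2)) /=.
rewrite ler_wpDl ?sumr_ge0// => [p _|]; first exact: f0.
rewrite le_eqVlt; apply/orP; left; apply/eqP; apply: eq_big => -[i j] /=.
  by rewrite -val_eqE /= -ltnNge ltn_neqAle andbC.
by rewrite /g fC.
Qed.

Lemma vectorizeE (R : Type) n L (X : tensor R n n L) l r z :
  vectorize X (mxtens_index (l, r)) z = X (node1 r) (node2 r) l.
Proof. by rewrite stackE mxE. Qed.

Lemma tensor_sqnorm_vectorize (R : comPzRingType) n L (X : tensor R n n L) :
  symmetric_slices X -> zero_diagonals X ->
  tensor_sqnorm X = 2 * sqnorm (vectorize X).
Proof.
move=> XC X0; rewrite /tensor_sqnorm sum_node_pairs => [|i j]; last first.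
  by apply: eq_bigr => l _; rewrite XC.
rewrite big1 ?add0r => [|i _]; last by apply: big1 => l _; rewrite X0 expr0n.
congr (_ * _); rewrite /sqnorm sum_mxtens exchange_big.
by apply: eq_bigr => l _; apply: eq_bigr => r _; rewrite vectorizeE.
Qed.

(** The test is the entry of [clustering_mx] for two nodes labelled [a] and [b], so each row has its
    single 1 in column [c0]. *)
Lemma class_pair_index m (a b : 'I_m) : exists c0 : 'I_(Mdim m),
  (forall c, (a == class1 c) && (b == class2 c) ||
             (a == class2 c) && (b == class1 c) = (c == c0)) /\
  ((class1 c0 = a /\ class2 c0 = b) \/ (class1 c0 = b /\ class2 c0 = a)).
Proof.
wlog ab : a b / (a <= b)%N.
  move=> hw; case: (leqP a b) => [|/ltnW] /hw // [c0 [cE cl]].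
  exists c0; split; last by case: cl; [right|left].
  by move=> c; rewrite -cE orbC; congr (_ || _); rewrite andbC.
pose p : class_pair m := exist _ (a, b) ab.
exists (enum_rank p); split; last by left; rewrite /class1 /class2 enum_rankK.
move=> c; rewrite -[RHS](can_eq (@enum_valK _)) enum_rankK -[RHS]val_eqE /=.
rewrite /class1 /class2.
rewrite -[sval _]/(val (enum_val c)).
have := valP (enum_val c); move: (val _) => [x y] /= xy.
rewrite xpair_eqE ![_ == a]eq_sym ![_ == b]eq_sym.
apply/orP/idP => [[//|/andP[/eqP ay /eqP bx]]|]; last by left.
(* A crossed match of two nondecreasing pairs forces both to be diagonal. *)
have xyE : x = y.
  by apply/val_inj/eqP; rewrite eqn_leq xy -ay -bx.
by rewrite ay bx xyE !eqxx.
Qed.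

Definition class_index m (a b : 'I_m) : 'I_(Mdim m) :=
  sval (cid (class_pair_index a b)).

Lemma class_index_eq m (a b : 'I_m) c :
  (a == class1 c) && (b == class2 c) || (a == class2 c) && (b == class1 c) =
  (c == class_index a b).
Proof. by rewrite /class_index; case: cid => c0 []. Qed.

Lemma class_indexP m (a b : 'I_m) (c0 := class_index a b) :
  (class1 c0 = a /\ class2 c0 = b) \/ (class1 c0 = b /\ class2 c0 = a).
Proof. by rewrite /c0 /class_index; case: cid => ? []. Qed.

Lemma class_indexC m (a b : 'I_m) : class_index a b = class_index b a.
Proof.
apply/eqP; rewrite -class_index_eq orbC andbC [X in _ || X]andbC.
by rewrite class_index_eq.
Qed.

Lemma class_indexK m (c : 'I_(Mdim m)) : class_index (class1 c) (class2 c) = c.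
Proof. by apply/esym/eqP; rewrite -class_index_eq !eqxx. Qed.

(** * Action of clustering matrices on class coefficients *)

Section LabelledClustering.
Variables (R : realType) (n m L : nat).
Variables (Z : 'I_L -> 'M[bool]_(n, m)) (f : 'I_L -> 'I_n -> 'I_m).
Hypothesis fE : forall l i k, Z l i k = (f l i == k).

Lemma block_clustering_mulE (u : 'cV[R]_(L * Mdim m)) l r z :
  (block_diagonal (fun l => clustering_mx R (Z l)) *m u)
    (mxtens_index (l, r)) z =
  u (mxtens_index (l, class_index (f l (node1 r)) (f l (node2 r)))) z.
Proof.
set c0 := class_index _ _; rewrite block_diagonal_mulE (bigD1 c0)//=.
rewrite big1 ?addr0 => [|c cE]; rewrite mxE !fE class_index_eq ?eqxx ?mul1r//.
by rewrite (negbTE cE) mul0r.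
Qed.

Lemma class_size_label l k : class_size (Z l) k = #|[pred i | f l i == k]|.
Proof. by apply: eq_card => i; rewrite !inE fE. Qed.

Lemma sum_by_class l (g : 'I_m -> R) :
  \sum_i g (f l i) = \sum_k (class_size (Z l) k)%:R * g k.
Proof.
rewrite (partition_big (f l) predT)//=; apply: eq_bigr => k _.
rewrite (eq_bigr (fun=> g k)) => [|i /eqP ->//].
by rewrite class_size_label sumr_const mulr_natl.
Qed.

(** Over ordered pairs of nodes, the classes [(a, b)] are hit [n_a n_b <= s^2] times. Returning to
    unordered pairs of classes costs a factor 2, which cancels the 2 gained from unordered pairs of
    nodes. *)
Lemma sqnorm_block_clustering_le (s : R) (u : 'cV[R]_(L * Mdim m)) :
  (forall l k, (class_size (Z l) k)%:R <= s) ->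
  sqnorm (block_diagonal (fun l => clustering_mx R (Z l)) *m u) <=
    s ^+ 2 * sqnorm u.
Proof.
move=> sizes; rewrite /sqnorm !sum_mxtens mulr_sumr; apply: ler_sum => l _.
pose U a b := u (mxtens_index (l, class_index a b)) 0 ^+ 2.
have UC a b : U a b = U b a by rewrite /U class_indexC.
have U0 a b : 0 <= U a b by exact: sqr_ge0.
rewrite (eq_bigr (fun r => U (f l (node1 r)) (f l (node2 r)))); last first.
  by move=> r _; rewrite block_clustering_mulE.
rewrite -(@ler_pM2l _ 2)//.
apply: (@le_trans _ _ (\sum_i \sum_j U (f l i) (f l j))).
  rewrite (sum_node_pairs (f := fun i j => U (f l i) (f l j))) => [|//].
  by rewrite lerDr sumr_ge0.
rewrite (sum_by_class l (fun a => \sum_j U a (f l j))).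
apply: (@le_trans _ _ (s * \sum_a s * \sum_b U a b)).
  rewrite mulr_sumr; apply: ler_sum => a _.
  have s0 : 0 <= s by exact: le_trans (sizes l a).
  apply: ler_pM; rewrite ?sumr_ge0//.
  rewrite (sum_by_class l (U a)) mulr_sumr; apply: ler_sum => b _.
  exact: ler_wpM2r.
rewrite -mulr_sumr mulrA -expr2 mulrCA ler_wpM2l ?sqr_ge0//.
apply: (le_trans (sum_class_pairs_le UC U0)).
by rewrite ler_wpM2l//; apply: ler_sum => c _; rewrite /U class_indexK.
Qed.

(** [class_index] fixes the two labels only up to order, which the symmetry of [G] absorbs. *)
Lemma vectorize_DSBM (G : tensor R m m L) (Lam : tensor R n n L) :
  is_DSBM Z G Lam ->
  vectorize Lam = block_diagonal (fun l => clustering_mx R (Z l)) *m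
                    stack (fun l => col l (class_prob_mx G)).
Proof.
move=> [_ GC _ LamE]; apply/colP => r; case: (mxtens_indexP r) => {}l {}r.
rewrite vectorizeE block_clustering_mulE stackE !mxE.
rewrite (LamE _ _ _ (f l (node1 r)) (f l (node2 r))) ?fE//.
  by case: (class_indexP (f l (node1 r)) (f l (node2 r))) => -[-> ->].
rewrite -val_eqE /node1 /node2.
by have := valP (enum_val r); case: ltngtP.
Qed.

End LabelledClustering.

(** * The oracle candidate and its bias *)

Section OracleCandidate.
Variables (R : realType) (n m L : nat) (H : 'M[R]_L) (D : 'M[R]_(Mdim m, L)).
Variables (Z : 'I_L -> 'M[bool]_(n, m)) (J : {ffun 'I_(Mdim m) -> {set 'I_L}}).

Definition oracle_set : {set 'I_(L * Mdim m)} :=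
  [set r | (mxtens_unindex r).1 \in J (mxtens_unindex r).2].

Definition oracle_candidate : candidate R n L :=
  @Candidate R n L m oracle_set
    (stack (fun l => \col_k (if l \in J k then D k l else 0))) Z.

Lemma card_oracle_set : #|oracle_set| = (\sum_k #|J k|)%N.
Proof.
rewrite -sum1_card big_mkcond /= sum_mxtens exchange_big /=.
apply: eq_bigr => k _; rewrite -sum1_card [RHS]big_mkcond /=.
by apply: eq_bigr => l _; rewrite inE mxtens_indexK.
Qed.

Lemma oracle_set_neq0 : (exists k, J k != finset.set0) ->
  oracle_set != finset.set0.
Proof.
move=> [k /set0Pn [l lJ]]; apply/set0Pn.
by exists (mxtens_index (l, k)); rewrite inE mxtens_indexK.
Qed.

Lemma oracle_candidate_support j : j \notin oracle_set ->
  cand_d oracle_candidate j 0 = 0.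
Proof.
case: (mxtens_indexP j) => l k; rewrite inE mxtens_indexK /= => /negbTE lJ.
by rewrite stackE mxE lJ.
Qed.

(** The error is [C W^T] applied to the coefficients outside [J], up to sign; [W^T] preserves norms
    and [C] multiplies squared norms by at most [s^2]. *)
Lemma oracle_bias (f : 'I_L -> 'I_n -> 'I_m) (s : R)
    (theta : 'cV_(L * Ndim n)) :
  (forall l i k, Z l i k = (f l i == k)) -> H *m H^T = 1%:M ->
  (forall l k, (class_size (Z l) k)%:R <= s) ->
  theta = block_diagonal (fun l => clustering_mx R (Z l)) *m
    ((transform_mx H (Mdim m))^T *m stack (fun l => col l D)) ->
  sqnorm (fitted H oracle_candidate - theta) <=
    s ^+ 2 * \sum_(k < Mdim m) \sum_(l < L | l \notin J k) D k l ^+ 2.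
Proof.
move=> fE HH sizes ->; rewrite /fitted -[X in X - _]mulmxA -!mulmxBr.
apply: (le_trans (sqnorm_block_clustering_le fE _ sizes)).
rewrite sqnorm_transform_tr// ler_wpM2l ?sqr_ge0//.
rewrite /sqnorm sum_mxtens exchange_big /=; apply: ler_sum => k _.
rewrite [leRHS]big_mkcond /=; apply: ler_sum => l _.
rewrite !mxE !mxtens_indexK; case: ifP => _ /=; last by rewrite sub0r sqrrN.
by rewrite subrr expr0n.
Qed.

End OracleCandidate.

(** * Consequences of balance and of the switching assumption *)

Section BalancedClasses.
Variables (R : realType) (n m : nat) (Z : 'M[bool]_(n, m)).
Hypotheses (Zc : is_clustering Z) (n_gt0 : (0 < n)%N).

Lemma clustering_gt0 : (0 < m)%N.
Proof.
have [f _] := clustering_label Zc.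
by case: n n_gt0 f => // n' _ f; exact: leq_ltn_trans (ltn_ord (f ord0)).
Qed.

(** The lower bound makes every class nonempty, and choosing one node per class is injective. This
    makes the true number of classes admissible for the estimator. *)
Lemma balanced_leq (alpha : R) : 0 < alpha ->
  (forall k, alpha * n%:R / m%:R <= (class_size Z k)%:R) -> (m <= n)%N.
Proof.
move=> alpha0 sizes; have [f fE] := clustering_label Zc.
have ex k : exists i, f i == k.
  have : (0 < class_size Z k)%N.
    rewrite -(ltr0n R) (lt_le_trans _ (sizes k))// divr_gt0 ?mulr_gt0 ?ltr0n//.
    exact: clustering_gt0.
  by rewrite /class_size => /card_gt0P[i]; rewrite inE fE; exists i.
have := @leq_card 'I_m 'I_n (fun k => xchoose (ex k)); rewrite !card_ord; apply.
move=> k k' /(congr1 f).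
by rewrite (eqP (xchooseP (ex k))) (eqP (xchooseP (ex k'))).
Qed.

End BalancedClasses.

(** Otherwise [n0 > n >= 1], and then [e n0^3 >= n0^3 >= n0^2 > n^2]. *)
Lemma switches_leq (R : realType) (n n0 : nat) : (0 < n)%N ->
  Num.sqrt (expR 1 * n0%:R ^+ 3) <= n%:R :> R -> (n0 <= n)%N.
Proof.
move=> n_gt0 h; rewrite leqNgt; apply/negP => nn0.
have e1 : 1 <= expR 1 :> R by rewrite (le_trans _ (expR_ge1Dx _))// lerDl.
have n0r : n%:R + 1 <= n0%:R :> R by rewrite natr1 ler_nat.
have n1 : 1 <= n%:R :> R by rewrite ler1n.
have : expR 1 * n0%:R ^+ 3 <= n%:R ^+ 2 :> R.
  rewrite -[leLHS]sqr_sqrtr ?mulr_ge0 ?expR_ge0 ?exprn_ge0//.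
  by rewrite lerXn2r ?nnegrE ?sqrtr_ge0.
apply/negP; rewrite -ltNge.
apply: (@lt_le_trans _ _ (n0%:R ^+ 3)); last by rewrite ler_peMl ?exprn_ge0.
move: (n%:R : R) (n0%:R : R) n0r n1 => x y xy x1.
have : x ^+ 2 < y ^+ 2 by rewrite ltrXn2r// ?nnegrE; lra.
have : y ^+ 2 <= y ^+ 3 by rewrite ler_weXn2l//; lra.
lra.
Qed.

(** * Transfer to the finite law of the data *)

Section FiniteLaw.
Local Open Scope ereal_scope.
Variables (R : realType) (d : measure_display) (T : measurableType d).
Variables (P : probability T R) (N : nat) (X : 'I_N -> {RV P >-> bool}).
Variable p : 'I_N -> R.
Hypothesis Xlaw : forall i, P (X i @^-1` [set true]) = (p i)%:E.
Hypothesis Xind : forall b : {ffun 'I_N -> bool},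
  P [set w | forall i, X i w = b i] = \prod_i P (X i @^-1` [set b i]).

Definition outcome w : {ffun 'I_N -> bool} := [ffun i => X i w].

Lemma measurable_outcome b : measurable [set w | forall i, X i w = b i].
Proof.
rewrite (_ : [set w | _] = \bigcap_(i in [set: 'I_N]) (X i @^-1` [set b i])).
  apply: fin_bigcap_measurable => [|i _]; first exact: finite_finset.
  by rewrite -[X in measurable X]setTI; apply: measurable_funP.
by apply/seteqP; split => [w h i _|w h i]; [exact: h|exact: (h i)].
Qed.

Lemma outcome_law (b : {ffun 'I_N -> bool}) :
  P [set w | forall i, X i w = b i] = (bernoulli_weight p b)%:E.
Proof.
rewrite Xind /bernoulli_weight -prodEFin; apply: eq_bigr => i _.
case: (b i); first exact: Xlaw.
have mX : measurable (X i @^-1` [set true]).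
  by rewrite -[X in measurable X]setTI; apply: measurable_funP.
rewrite (_ : X i @^-1` [set false] = ~` (X i @^-1` [set true])).
  by rewrite probability_setC// Xlaw.
by apply/seteqP; split => w /=; case: (X i w).
Qed.

(** The data take finitely many values, so a function of them is a combination of indicators; its
    measurability and its integral are read off from this. *)
Lemma outcome_indic (f : {ffun 'I_N -> bool} -> R) w :
  (f (outcome w))%:E =
  \sum_b (f b)%:E * (\1_[set w | forall i, X i w = b i] w)%:E.
Proof.
rewrite (bigD1 (outcome w))//= big1 ?adde0 => [|b bw].
  rewrite indicE mem_set ?mule1// => i.
  by rewrite /outcome ffunE.
rewrite indicE memNset ?mule0//= => h; case/eqP: bw.
by apply/ffunP => i; rewrite ffunE h.
Qed.

Lemma measurable_fun_outcome (f : {ffun 'I_N -> bool} -> R) :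
  measurable_fun setT (fun w => f (outcome w)).
Proof.
apply/measurable_EFinP.
rewrite (_ : _ \o _ = fun w => \sum_b (f b)%:E *
    (\1_[set w | forall i, X i w = b i] w)%:E); last first.
  by apply/funext => w; rewrite -outcome_indic.
apply: emeasurable_sum => b; apply: measurable_funeM.
by apply/measurable_EFinP/measurable_indicP; exact: measurable_outcome.
Qed.

Lemma integral_outcome (f : {ffun 'I_N -> bool} -> R) :
  (forall b, 0 <= f b)%R ->
  \int[P]_w (f (outcome w))%:E = (\sum_b bernoulli_weight p b * f b)%:E.
Proof.
move=> f0; under eq_integral do rewrite outcome_indic.
rewrite ge0_integral_sum//=; last 2 first.
- move=> b; apply: measurable_funeM.
  by apply/measurable_EFinP/measurable_indicP; exact: measurable_outcome.
- by move=> b w _; rewrite mule_ge0// lee_fin.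
rewrite -sumEFin; apply: eq_bigr => b _.
rewrite ge0_integralZl_EFin//; last first.
  by apply/measurable_EFinP/measurable_indicP; exact: measurable_outcome.
rewrite integral_indic ?setIT//; last exact: measurable_outcome.
by rewrite [X in _ * X](outcome_law b) EFinM muleC.
Qed.

End FiniteLaw.

Lemma Mdim_gt0 m : (0 < m)%N -> (0 < Mdim m)%N.
Proof. by rewrite MdimE; case: m => // m _; rewrite half_gt0; nia. Qed.

(** * Deviation and expectation bounds for the estimator *)

Unset Implicit Arguments.

Theorem theorem2 (R : realType) (aleph1 aleph2 : R)
  (Haleph : 0 < aleph1 <= 1 /\ 1 <= aleph2)
  (d : measure_display) (T : measurableType d) (P : probability T R)
  (n L n0 : nat) (Hn : (0 < n)%N) (HL : (0 < L)%N)
  (Hnn0 : Num.sqrt (expR 1 * n0%:R ^+ 3) <= n%:R :> R)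
  (H : 'M[R]_L) (HH : H *m H^T = 1%:M)
  (* the true model *)
  (mstar : nat) (Zstar : 'I_L -> 'M[bool]_(n, mstar))
  (HZ : Zbal n0 aleph1 aleph2 Zstar)
  (Gstar : tensor R mstar mstar L) (Lamstar : tensor R n n L)
  (HLam : is_DSBM Zstar Gstar Lamstar)
  (* the observations *)
  (B : 'I_n -> 'I_n -> 'I_L -> {RV P >-> bool})
  (HBsym : forall i j l w, B i j l w = B j i l w)
  (HBdiag : forall i l w, B i i l w = false)
  (HBlaw : forall (i j : 'I_n) l, (i < j)%N ->
     P (B i j l @^-1` [set true]) = (Lamstar i j l)%:E)
  (HBind : mutually_independent
     (fun p : node_pair n * 'I_L => B (val p.1).1 (val p.1).2 p.2))
  (* the estimator *)
  (chat : T -> candidate R n L)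
  (Hchat : forall w, is_PLS_estimator n0 aleph1 aleph2 H
     (vectorize (fun i j l => (B i j l w)%:R)) (chat w))
  (Lamhat : 'I_n -> 'I_n -> 'I_L -> {RV P >-> R})
  (HLamhat : forall w, let X := fun i j l => Lamhat i j l w in
     [/\ symmetric_slices X, zero_diagonals X
       & vectorize X = fitted H (chat w)]) :
  let Dstar := class_prob_mx Gstar *m H^T in
  let loss w := tensor_sqnorm (fun i j l => Lamhat i j l w - Lamstar i j l)
                  / (n%:R ^+ 2 * L%:R) in
  let bound := oracle_bound n n0 aleph2 Dstar in
  (forall t : R, 0 < t ->
     ((1 - 9 * expR (- t))%:E <=
      P [set w | (loss w <= bound + 38 * t / (n%:R ^+ 2 * L%:R))%R])%E) /\
  ('E_P[loss] <= (bound + 342 / (n%:R ^+ 2 * L%:R))%:E)%E.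
Proof.
move=> Dstar loss bound.
have [Zc Zs Zsizes] := HZ.
have n0n := switches_leq Hn Hnn0.
have m_gt0 : (0 < mstar)%N by exact: clustering_gt0 (Zc (Ordinal HL)) Hn.
have mn : (mstar <= n)%N.
  apply: (balanced_leq (Zc (Ordinal HL)) Hn (alpha := aleph1)) => [|k].
    by case: Haleph => /andP[].
  by case/andP: (Zsizes (Ordinal HL) k).
have /choice [f fE] l := clustering_label (Zc l).
pose nL : R := n%:R ^+ 2 * L%:R.
have nL_gt0 : 0 < nL by rewrite mulr_gt0 ?exprn_gt0// ltr0n.
pose theta := vectorize Lamstar.
pose X (r : 'I_(L * Ndim n)) : {RV P >-> bool} :=
  B (node1 (mxtens_unindex r).2) (node2 (mxtens_unindex r).2)
    (mxtens_unindex r).1.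
have Xlaw r : P (X r @^-1` [set true]) = (theta r 0)%:E.
  rewrite HBlaw; last exact: (valP (enum_val (mxtens_unindex r).2)).
  by rewrite !mxE.
have theta01 r : 0 <= theta r 0 <= 1.
  have mX : measurable (X r @^-1` [set true]).
    by rewrite -[Y in measurable Y]setTI; apply: measurable_funP.
  by rewrite -!lee_fin -Xlaw measure_ge0 probability_le1.
(* Independence over all indices (pair, time), with singleton events, is carried to stacked
   positions by the bijection [g]. *)
have Xind (b : {ffun 'I_(L * Ndim n) -> bool}) :
    P [set w | forall r, X r w = b r] = (\prod_r P (X r @^-1` [set b r]))%E.
  pose h (q : node_pair n * 'I_L) : 'I_(L * Ndim n) :=
    mxtens_index (q.2, enum_rank q.1).
  pose g (r : 'I_(L * Ndim n)) : node_pair n * 'I_L :=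
    (enum_val (mxtens_unindex r).2, (mxtens_unindex r).1).
  have hK : cancel h g.
    by move=> [q l]; rewrite /g /h mxtens_indexK /= enum_rankK.
  have gK : cancel g h.
    move=> r; case: (mxtens_indexP r) => l q.
    by rewrite /g /h mxtens_indexK /= enum_valK.
  have := HBind [set: _]%SET (fun q => [set b (h q)]) (fun _ => I).
  rewrite (_ : [set w | _] = [set w | forall r, X r w = b r]); last first.
    apply/seteqP; split => w /= hw.
      by move=> r; have := hw (g r) (finset.in_setT _); rewrite gK.
    move=> q _; have := hw (h q).
    by rewrite /X /h mxtens_indexK /node1 /node2 /= enum_rankK.
  move=> ->; rewrite (reindex g) /=; last by exists h => q _.
  by apply: eq_big => r; rewrite ?inE// gK.
pose xi := noise (fun r => theta r 0).
have dataE w : vectorize (fun i j l => (B i j l w)%:R) =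
    theta + xi (outcome X w).
  apply/colP => r; rewrite !mxE ffunE /X; ring.
(* The same [arg min] as in [oracle_bound], so that [bound] is its value by conversion. *)
pose J := [arg min_(J < [ffun=> [set: 'I_L]%SET] |
    [exists k, J k != finset.set0]) oracle_term n n0 aleph2 Dstar J]%O.
have J_ex : exists k, J k != finset.set0.
  rewrite /J; case: Order.TotalTheory.arg_minP => [|J' /existsP//].
  apply/existsP; exists (Ordinal (Mdim_gt0 m_gt0)); rewrite ffunE.
  by apply/set0Pn; exists (Ordinal HL); rewrite inE.
pose c0 := oracle_candidate Dstar Zstar J.
have feas0 : feasible n0 aleph1 aleph2 c0.
  split => [|||//]; first by rewrite /= m_gt0.
    exact: oracle_set_neq0.
  by move=> j; apply: oracle_candidate_support.
pose v := fitted H c0 - theta.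
have bias : sqnorm v <= (aleph2 * n%:R / mstar%:R) ^+ 2 *
    \sum_(k < Mdim mstar) \sum_(l < L | l \notin J k) Dstar k l ^+ 2.
  apply: (oracle_bias J fE HH) => [l k|].
    by case/andP: (Zsizes l k).
  by rewrite /theta (vectorize_DSBM fE HLam) transform_tr_stack.
pose Psi := @fluctuation R n n0 L H theta v.
have Psi1 b : 1 <= Psi b by exact: fluctuation_ge1.
have mean_Psi : \sum_b bernoulli_weight (fun r => theta r 0) b * Psi b <= 9.
  exact: mean_fluctuation_le.
have lossE w : loss w = 2 * sqnorm (fitted H (chat w) - theta) / nL.
  have [XC X0 <-] := HLamhat w; have [_ _ L0 LE] := HLam.
  rewrite /loss tensor_sqnorm_vectorize.
  - congr (_ * sqnorm _ / _); apply/colP => r; by rewrite !mxE.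
  - have [_ GC _ _] := HLam.
    move=> i j l; rewrite XC; congr (_ - _).
    have [->//|ij] := eqVneq i j.
    rewrite (LE i j l (f l i) (f l j)) ?fE// (LE j i l (f l j) (f l i)) ?fE//.
    by rewrite eq_sym.
  - by move=> i l; rewrite X0 L0 subrr.
(* Passing from vectors to tensors doubles the constants 3, 2 and 19 of the oracle inequality into
   6, 4 and 38; the factor [n^2] in the bias cancels against the normalization. *)
have loss_le w : loss w <= bound + 38 / nL * ln (Psi (outcome X w)).
  have [feas opt] := Hchat w.
  have := @oracle_inequality R n n0 L H theta aleph1 aleph2 (outcome X w)
    (chat w) c0 feas.
  rewrite -/xi -dataE => /(_ (opt _ feas0)); rewrite -/v -/(Psi _).
  rewrite [cand_m _]/= [cand_J _]/= card_oracle_set lossE.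
  move: (ln _) (sqnorm (_ - theta)) => lnPsi x ineq.
  have -> : bound = oracle_term n n0 aleph2 Dstar J by [].
  rewrite /oracle_term -/nL; move: bias ineq.
  move: (Pen _ _ _ _ _ _) (sqnorm v) (\sum_(k < _) _) => pen y S bias ineq.
  have -> : 6 * aleph2 ^+ 2 / (mstar%:R ^+ 2 * L%:R) * S + 4 * pen / nL +
      38 / nL * lnPsi =
      (6 * ((aleph2 * n%:R / mstar%:R) ^+ 2 * S) + 4 * pen + 38 * lnPsi) / nL.
    by rewrite /nL; field; rewrite !pnatr_eq0 -!lt0n m_gt0 HL Hn.
  rewrite ler_wpM2r ?invr_ge0 ?(ltW nL_gt0)//; lra.
have meas_loss : measurable_fun setT loss.
  apply: measurable_funM; last exact: measurable_cst.
  apply: measurable_sum => i; apply: measurable_sum => j.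
  apply: measurable_sum => l; apply: measurable_funX.
  by apply: measurable_funB; [exact: measurable_funP|exact: measurable_cst].
have integral_f := integral_outcome Xlaw Xind.
have w_ge0 := bernoulli_weight_ge0 theta01.
split=> [t t0|].
  set S := [set w | _].
  have mS : measurable S.
    rewrite (_ : S = loss @^-1` `]-oo, (bound + 38 * t / nL)%R]).
      by rewrite -[Y in measurable Y]setTI; apply: meas_loss.
    by apply/seteqP; split => w; rewrite /S /= in_itv.
  (* The event is bounded below by [ln Psi <= t], whose indicator is a function of the data alone,
     so that its probability is a finite sum. *)
  pose good b : R := (ln (Psi b) <= t)%R%:R.
  (* Markov's inequality in pointwise form: if [ln Psi > t] then [exp (-t) Psi > 1] and the
     left-hand side is negative. *)
  have good_ge b : 1 - expR (- t) * Psi b <= good b.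
    rewrite /good; case: (leP (ln (Psi b)) t) => [_|tb] /=.
      rewrite lerBlDr lerDl mulr_ge0 ?expR_ge0//.
      exact: le_trans (Psi1 b).
    rewrite subr_le0 expRN ler_pdivlMl ?expR_gt0// mulr1.
    rewrite -[leRHS]lnK ?ler_expR; first exact: ltW.
    by rewrite posrE (lt_le_trans _ (Psi1 b)).
  have -> : P S = (\int[P]_w (\1_S w)%:E)%E by rewrite integral_indic ?setIT.
  apply: (@le_trans _ _ (\int[P]_w (good (outcome X w))%:E)%E).
    rewrite integral_f => [|b]; last by rewrite /good ler0n.
    rewrite lee_fin; apply: (@le_trans _ _ (\sum_b
      bernoulli_weight (fun r => theta r 0) b * (1 - expR (- t) * Psi b))).
      rewrite (eq_bigr (fun b => bernoulli_weight (fun r => theta r 0) b -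
        expR (- t) * (bernoulli_weight (fun r => theta r 0) b * Psi b))).
        rewrite sumrB sum_bernoulli_weight -mulr_sumr lerD2l lerN2 mulrC.
        by rewrite ler_wpM2r ?expR_ge0.
      by move=> b _; ring.
    by apply: ler_sum => b _; exact: ler_wpM2l.
  apply: ge0_le_integral => //=.
  - by move=> w _; rewrite lee_fin /good ler0n.
  - by apply/measurable_EFinP; exact: (measurable_fun_outcome X good).
  - by apply/measurable_EFinP/measurable_indicP.
  move=> w _; rewrite lee_fin /good indicE.
  case: (leP (ln (Psi (outcome X w))) t) => [lt|_] /=; last exact: ler0n.
  rewrite mem_set//; rewrite /S /=; apply: (le_trans (loss_le w)).
  by rewrite lerD2l mulrAC ler_wpM2r ?invr_ge0 ?(ltW nL_gt0)// ler_wpM2l.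
(* Nonnegativity is what [integral_outcome] requires of the majorant [g] below. *)
have bound_ge0 : 0 <= bound.
  have -> : bound = oracle_term n n0 aleph2 Dstar J by [].
  rewrite /oracle_term -/nL addr_ge0//.
    apply: mulr_ge0.
      by apply: divr_ge0; rewrite mulr_ge0 ?sqr_ge0.
    by apply: sumr_ge0 => k _; apply: sumr_ge0 => l _; exact: sqr_ge0.
  rewrite divr_ge0 ?(ltW nL_gt0)// mulr_ge0// Pen_ge0//.
  rewrite -(card_oracle_set J) card_gt0 oracle_set_neq0//=.
  by rewrite (leq_trans (max_card _))// card_ord.
pose g b : R := bound + 38 / nL * Psi b.
have g_ge0 b : 0 <= g b.
  rewrite addr_ge0// mulr_ge0 ?divr_ge0 ?(ltW nL_gt0)//.
  exact: le_trans (Psi1 b).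
rewrite unlock; apply: (@le_trans _ _ (\int[P]_w (g (outcome X w))%:E)%E).
  apply: ge0_le_integral => //=.
  - move=> w _; rewrite lee_fin lossE mulr_ge0 ?invr_ge0 ?(ltW nL_gt0)//.
    by rewrite mulr_ge0// sqnorm_ge0.
  - exact/measurable_EFinP.
  - by apply/measurable_EFinP; exact: (measurable_fun_outcome X g).
  move=> w _; rewrite lee_fin /g; apply: (le_trans (loss_le w)).
  rewrite lerD2l ler_wpM2l ?divr_ge0 ?(ltW nL_gt0)//.
  by apply/ltW/ln_sublinear; exact: lt_le_trans (Psi1 _).
rewrite integral_f// lee_fin.
rewrite (eq_bigr (fun b => bound * bernoulli_weight (fun r => theta r 0) b +
  38 / nL * (bernoulli_weight (fun r => theta r 0) b * Psi b))); last first.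
  by move=> b _; rewrite /g; ring.
rewrite big_split /= -!mulr_sumr sum_bernoulli_weight mulr1 lerD2l.
(* The 9 is the bound on the mean of [Psi]. *)
rewrite (_ : 342 / _ = 38 / nL * 9); last first.
  by rewrite -/nL; field; rewrite gt_eqF.
by rewrite ler_wpM2l ?divr_ge0 ?(ltW nL_gt0).
Qed.
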